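(* Let $B$ be a paracompact topological space, let $\mathcal{U}=\{U_i\}_{i\in I}$ be a countable open cover of $B$, let $d\ge 1$ and let $\epsilon\in[0,\infty]$. The map $\mathsf{cl}':\mathsf Z^1_\epsilon(\mathcal{U};O(d))\to[B,\mathsf{Gr}(d)^{\sqrt2\epsilon}]$ described in the context induces a map $$\mathsf{cl}:\check{\mathsf H}^1_\epsilon(\mathcal{U};O(d))\to[B,\mathsf{Gr}(d)^{\sqrt2\epsilon}]$$ such that, if $\mathsf d_{\check{\mathsf H}}(\Omega,\Lambda)<\delta$ in $\check{\mathsf H}^1_\epsilon(\mathcal{U};O(d))$, then $\mathsf{cl}(\Omega)$ and $\mathsf{cl}(\Lambda)$ become equal in $[B,\mathsf{Gr}(d)^{\sqrt2(\epsilon+\delta)}]$. Moreover, if $\mathcal{V}$ is a countable open cover of $B$, $\mu,\nu:\mathcal{V}\to\mathcal{U}$ are refinements, and $\Omega\in\check{\mathsf H}^1_\epsilon(\mathcal{U};O(d))$, then $\mathsf{cl}(\mu(\Omega))$ and $\mathsf{cl}(\nu(\Omega))$ become equal in $[B,\mathsf{Gr}(d)^{2\sqrt2\epsilon}]$.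
   Context: Paracompact means Hausdorff and every open cover has a locally finite open refinement. $\|A\|=\sqrt{\mathrm{tr}(A^tA)}$ is the Frobenius norm; $O(d)$ carries the Frobenius distance. $[X,Y]$ is the set of homotopy classes of continuous maps. $\mathsf{Gr}(d,n)=\{A\in\mathbb{R}^{n\times n}: A=A^t=A^2,\ \mathrm{rank}\,A=d\}$, and $\mathsf V(d,n)$ is the set of real $n\times d$ matrices with orthonormal columns. $\mathsf{Gr}(d)$, $\mathsf V(d)$, $\mathbb{R}^{\infty\times\infty}$ are the unions over $n$ of $\mathsf{Gr}(d,n)$, $\mathsf V(d,n)$, $\mathbb{R}^{n\times n}$ (padding by zeros), with the direct limit topology. For $\epsilon>0$, $\mathsf{Gr}(d)^\epsilon\subseteq\mathbb{R}^{\infty\times\infty}$ is the set of matrices at Frobenius distance $<\epsilon$ from some element of $\mathsf{Gr}(d)$ (so $\mathsf{Gr}(d)^\infty=\mathbb{R}^{\infty\times\infty}$); $\mathsf{Gr}(d)^0=\mathsf{Gr}(d)$. $N(\mathcal{U})$ is the nerve of $\mathcal{U}$; write $(i_0\dots i_n)\in N(\mathcal{U})$ for an ordered list with $U_{i_n}\cap\dots\cap U_{i_0}\neq\emptyset$. A 1-cochain is a family of continuous maps $\Omega=\{\Omega_{ij}:U_j\cap U_i\to O(d)\}_{(ij)\in N(\mathcal{U})}$ with $\Omega_{ij}(y)=\Omega_{ji}(y)^{-1}$. For $\epsilon\in(0,\infty]$ it is an $\epsilon$-approximate cocycle if $\|\Omega_{ij}(y)\Omega_{jk}(y)-\Omega_{ik}(y)\|<\epsilon$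 for all $(ijk)\in N(\mathcal{U})$ and $y\in U_k\cap U_j\cap U_i$; for $\epsilon=0$ one requires equality. These form $\mathsf Z^1_\epsilon(\mathcal{U};O(d))$, with metric $\mathsf d_{\mathsf Z}(\Omega,\Lambda)=\sup_{(ij)}\sup_{y}\|\Omega_{ij}(y)-\Lambda_{ij}(y)\|$. Families $\Theta=\{\Theta_i:U_i\to O(d)\}_{i\in I}$ of continuous maps act by $(\Theta\cdot\Omega)_{ij}=\Theta_i\Omega_{ij}\Theta_j^{-1}$; $\check{\mathsf H}^1_\epsilon(\mathcal{U};O(d))$ is the quotient by this action and $\mathsf d_{\check{\mathsf H}}$ is the infimum of $\mathsf d_{\mathsf Z}$ over representatives. Construction of $\mathsf{cl}'$. Choose a partition of unity $\phi=\{\phi_i\}_{i\in I}$ subordinate to $\mathcal{U}$ and an injection $\iota:I\to\{1,2,3,\dots\}$. For $\Omega\in\mathsf Z^1_\epsilon(\mathcal{U};O(d))$ define $\Phi_i:U_i\to\mathsf V(d)$ by declaring, for each $j\in I$, the rows of $\Phi_i(y)$ from $d\,\iota(j)$ to $d(\iota(j)+1)-1$ to be $\sqrt{\phi_j(y)}\,\Omega_{ij}(y)^t$ (zero if $y\notin U_j$), all other rows zero. Then $\mathsf{cl}'(\Omega)$ is the homotopy class of $B\to\mathsf{Gr}(d)^{\sqrt2\epsilon}$, $y\mapsto\sum_{i\in I}\phi_i(y)\,\Phi_i(y)\Phi_i(y)^t$; it does not depend on the choice of $\phi$ and $\iota$. Refinements. For open covers $\mathcal{V}=\{V_j\}_{j\in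 J}$ and $\mathcal{U}=\{U_i\}_{i\in I}$ of $B$, a refinement $\nu:\mathcal{V}\to\mathcal{U}$ is a function $\nu:J\to I$ with $V_j\subseteq U_{\nu(j)}$ for all $j$. It induces $\nu:\mathsf Z^1_\epsilon(\mathcal{U};O(d))\to\mathsf Z^1_\epsilon(\mathcal{V};O(d))$ by $\nu(\Omega)_{jk}=\Omega_{\nu(j)\nu(k)}$ restricted to $V_k\cap V_j$, and hence a map on $\check{\mathsf H}^1_\epsilon$. *)

(* Defs.v *)
From HB Require Import structures.
From mathcomp Require Import all_boot all_order all_algebra generic_quotient.
From mathcomp Require Import all_classical all_reals all_analysis.
From mathcomp Require Import lra.

Set Implicit Arguments.
Unset Strict Implicit.
Unset Printing Implicit Defensive.

Import Order.TTheory GRing.Theory Num.Theory.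
Import numFieldNormedType.Exports.

Local Open Scope classical_set_scope.
Local Open Scope ring_scope.
Local Open Scope quotient_scope.

Definition paracompact (B : topologicalType) : Prop :=
  hausdorff_space B /\
  forall C : set (set B),
    (forall S, C S -> open S) -> \bigcup_(S in C) S = setT ->
    exists D : set (set B),
      [/\ forall S, D S -> open S,
          \bigcup_(S in D) S = setT,
          forall S, D S -> exists2 S', C S' & S `<=` S'
        & forall y : B, exists2 W, nbhs y W &
            finite_set [set S | D S /\ S `&` W !=set0]].

Definition open_cover (B : topologicalType) (I : Type) (U : I -> set B) : Prop :=
  (forall i, open (U i)) /\ forall y, exists i, U i y.

Section Homotopy.
Context {R : realType} {X Y : topologicalType}.

(* Continuity into the subspace A is continuity into Y. *)
Record map_into (A : set Y) := MapInto {
  map_fun :> X -> Y;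
  map_continuous : continuous map_fun;
  map_in : forall x, A (map_fun x) }.

HB.instance Definition _ (A : set Y) := gen_eqMixin (map_into A).
HB.instance Definition _ (A : set Y) := gen_choiceMixin (map_into A).

Definition homotopic (A : set Y) (f g : X -> Y) : Prop :=
  exists H : X * R -> Y,
    [/\ {within [set: X] `*` `[0, 1], continuous H},
        forall (x : X) (t : R), 0 <= t <= 1 -> A (H (x, t)),
        forall x, H (x, 0) = f x
      & forall x, H (x, 1) = g x].

Lemma homotopic_refl (A : set Y) (f : map_into A) : homotopic A f f.
Proof.
exists (fun p => f p.1); split => //; last by move=> x t _; exact: map_in.
apply: continuous_subspaceT => p.
by apply: continuous_comp; [exact: cvg_fst|exact: map_continuous].
Qed.

Lemma continuous_pair (P Q Z : topologicalType) (s : P -> Q) (t : P -> Z) :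
  continuous s -> continuous t -> continuous (fun p => (s p, t p)).
Proof. by move=> cs ct p; apply: cvg_pair; [exact: cs|exact: ct]. Qed.

Lemma continuous_fst (P Q : topologicalType) : continuous (@fst P Q).
Proof. by move=> p; exact: cvg_fst. Qed.

Lemma continuous_snd (P Q : topologicalType) : continuous (@snd P Q).
Proof. by move=> p; exact: cvg_snd. Qed.

Lemma continuous_within_comp (P Q Z : topologicalType) (D : set P) (E : set Q)
    (s : P -> Q) (h : Q -> Z) : continuous s -> (forall p, D p -> E (s p)) ->
  {within E, continuous h} -> {within D, continuous (h \o s)}.
Proof.
move=> cs sE ch; apply/continuousP => O oO.
have /continuousP /(_ O oO) /open_subspaceP [V oV hV] := ch.
apply/open_subspaceP; exists (s @^-1` V); first by move/continuousP: cs; apply.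
apply/seteqP; split => p [/= h1 Dp]; split=> //.
  by have : (V `&` E) (s p) by [split=> //; exact: sE]; rewrite hV => -[].
by have : ((h @^-1` O) `&` E) (s p) by [split=> //; exact: sE]; rewrite -hV => -[].
Qed.

Lemma continuous_within_eq (P Z : topologicalType) (D : set P) (f g : P -> Z) :
  (forall p, D p -> f p = g p) ->
  {within D, continuous f} -> {within D, continuous g}.
Proof. by move=> fg; apply: subspace_eq_continuous => p /set_mem /fg. Qed.

Lemma homotopic_sym (A : set Y) (f g : X -> Y) :
  homotopic A f g -> homotopic A g f.
Proof.
move=> [H [cH HA H0 H1]]; exists (fun p => H (p.1, 1 - p.2)); split.
- apply: (@continuous_within_comp _ _ _ _ _ (fun p : X * R => (p.1, 1 - p.2)) H _ _ cH).
    apply: continuous_pair; first exact: continuous_fst.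
    by move=> p; apply: cvgB; [exact: cvg_cst|exact: cvg_snd].
  move=> -[x t] [_ /=]; rewrite !in_itv/= => /andP[t0 t1]; split=> //=.
  by rewrite subr_ge0 t1 lerBlDr lerDl t0.
- move=> x t /= /andP[t0 t1]; apply: HA.
  by rewrite subr_ge0 t1 lerBlDr lerDl t0.
- by move=> x /=; rewrite subr0 H1.
- by move=> x /=; rewrite subrr H0.
Qed.

Lemma homotopic_trans (A : set Y) (g f h : X -> Y) :
  homotopic A f g -> homotopic A g h -> homotopic A f h.
Proof.
move=> [H [cH HA H0 H1]] [K [cK KA K0 K1]].
pose L (p : X * R) := if p.2 <= 2^-1 then H (p.1, 2 * p.2) else K (p.1, 2 * p.2 - 1).
have h0 : (0 : R) < 2^-1 by lra.
have h1 : (2^-1 : R) < 1 by lra.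
have h2 : 2 * 2^-1 = 1 :> R by lra.
have c2 : continuous (fun p : X * R => 2 * p.2).
  by move=> p; apply: cvgM; [exact: cvg_cst|exact: cvg_snd].
have in1 (t : R) : 0 <= t -> t <= 2^-1 -> 0 <= 2 * t <= 1.
  by move=> t0 t1; apply/andP; split; lra.
have in2 (t : R) : 2^-1 <= t -> t <= 1 -> 0 <= 2 * t - 1 <= 1.
  by move=> t0 t1; apply/andP; split; lra.
exists L; split.
- have -> : [set: X] `*` `[(0:R), 1] =
      [set p | `[(0:R), 2^-1]%classic p.2] `|` [set p | `[(2^-1:R), 1]%classic p.2].
    apply/seteqP; split=> -[x t] /=; rewrite ?in_itv/=.
      by move=> [_ /andP[t0 t1]]; case: (leP t 2^-1) => ht; [left|right];
        rewrite ?t0 ?t1 ?(ltW ht).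
    move=> [] /andP[t0 t1]; split=> //; apply/andP; split=> //.
      exact: le_trans t1 (ltW h1).
    exact: le_trans (ltW h0) t0.
  have cl (a b : R) : closed [set p : X * R | `[a, b]%classic p.2].
    apply: (@preimage_closed _ _ (snd : X * R -> R) `[a, b]%classic).
      by move=> p _; exact: continuous_snd.
    exact: interval_closed.
  apply: withinU_continuous; [exact: cl|exact: cl| |].
    apply: (@continuous_within_eq _ _ _ (fun p : X * R => H (p.1, 2 * p.2))).
      by move=> p; rewrite /= in_itv/= /L => /andP[_ ->].
    apply: (@continuous_within_comp _ _ _ _ _
      (fun p : X * R => (p.1, 2 * p.2)) H _ _ cH).
      by apply: continuous_pair; [exact: continuous_fst|exact: c2].
    by move=> [x t] /=; rewrite !in_itv/= => /andP[t0 t1]; split=> //; exact: in1.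
  apply: (@continuous_within_eq _ _ _ (fun p : X * R => K (p.1, 2 * p.2 - 1))).
    move=> [x t]; rewrite /= in_itv/= /L /= => /andP[t0 t1].
    case: (leP t 2^-1) => // ht.
    have -> : t = 2^-1 by apply/eqP; rewrite eq_le ht t0.
    by rewrite h2 subrr K0 H1.
  apply: (@continuous_within_comp _ _ _ _ _
    (fun p : X * R => (p.1, 2 * p.2 - 1)) K _ _ cK).
    apply: continuous_pair; first exact: continuous_fst.
    by move=> p; apply: cvgB; [exact: c2|exact: cvg_cst].
  by move=> [x t] /=; rewrite !in_itv/= => /andP[t0 t1]; split=> //; exact: in2.
- move=> x t /andP[t0 t1]; rewrite /L /=.
  case: (leP t 2^-1) => ht; first by apply: HA; rewrite in1.
  by apply: KA; rewrite in2// ltW.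
- by move=> x; rewrite /L /= mulr0 (ltW h0).
- move=> x; rewrite /L /= leNgt h1/= mulr1.
  by rewrite (_ : 2 - 1 = 1 :> R)//; lra.
Qed.

Lemma homotopic_sub (A A' : set Y) (f g : X -> Y) : A `<=` A' ->
  homotopic A f g -> homotopic A' f g.
Proof. by move=> AA' [H [cH HA H0 H1]]; exists H; split=> // x t /HA /AA'. Qed.

Definition homotopicb (A : set Y) (f g : map_into A) : bool := `[< homotopic A f g >].

Lemma homotopicb_equiv (A : set Y) : equiv_class_of (@homotopicb A).
Proof.
split=> [f|f g|g f h]; first by apply/asboolP; exact: homotopic_refl.
  by apply/asbool_equiv_eq; split; exact: homotopic_sym.
by move=> /asboolP fg /asboolP gh; apply/asboolP; exact: homotopic_trans fg gh.
Qed.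

Canonical homotopicb_equiv_rel (A : set Y) :=
  EquivRelPack (homotopicb_equiv A).

End Homotopy.
Arguments map_into : clear implicits.
Arguments homotopic R {X Y} A f g.

(* [X, A] for a subspace A of Y. *)
Definition hclasses (R : realType) (X Y : topologicalType) (A : set Y) :=
  {eq_quot (@homotopicb R X Y A)}.
Arguments hclasses R X {Y} A.

HB.instance Definition _ (R : realType) (X Y : topologicalType) (A : set Y) :=
  Choice.on (hclasses R X A).
HB.instance Definition _ (R : realType) (X Y : topologicalType) (A : set Y) :=
  EqQuotient.on (hclasses R X A).

Definition map_incl (X Y : topologicalType) (A A' : set Y) (AA' : A `<=` A')
    (f : map_into X Y A) : map_into X Y A' :=
  MapInto (@map_continuous _ _ _ f) (fun x => AA' _ (map_in f x)).

Definition hincl (R : realType) (X Y : topologicalType) (A A' : set Y)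
    (AA' : A `<=` A') (c : hclasses R X A) : hclasses R X A' :=
  \pi_(hclasses R X A') (map_incl AA' (repr c)).

Lemma hclassesP (R : realType) (X Y : topologicalType) (A : set Y)
    (f g : map_into X Y A) :
  \pi_(hclasses R X A) f = \pi_(hclasses R X A) g <-> homotopic R A f g.
Proof. by split=> [/eqmodP/asboolP//|fg]; apply/eqmodP/asboolP. Qed.

Lemma hinclE (R : realType) (X Y : topologicalType) (A A' : set Y)
    (AA' : A `<=` A') (f : map_into X Y A) :
  hincl AA' (\pi_(hclasses R X A) f) = \pi_(hclasses R X A') (map_incl AA' f).
Proof.
apply/hclassesP; apply: (homotopic_sub AA').
by apply/hclassesP; rewrite reprK.
Qed.

Section MatrixContinuity.
Context {R : realType}.

Lemma cvg_mx (T : Type) (F : set_system T) (FF : Filter F) m n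
    (f : T -> 'M[R]_(m, n)) (M : 'M[R]_(m, n)) :
  (forall i j, (fun t => f t i j) @ F --> M i j) -> f @ F --> M.
Proof.
move=> h A [P nP PA]; apply: (filterS (P := [set t | forall i j, P i j (f t i j)])).
  by move=> t Pt; exact: PA.
apply: filter_forall => i; apply: filter_forall => j.
exact: h (nP i j).
Qed.

Lemma cvg_coord (T : Type) (F : set_system T) (FF : Filter F) m n
    (f : T -> 'M[R]_(m, n)) (M : 'M[R]_(m, n)) i j :
  f @ F --> M -> (fun t => f t i j) @ F --> M i j.
Proof.
by move=> h; exact: (cvg_comp f (fun N => N i j) h (@coord_continuous _ _ _ i j M)).
Qed.

Lemma cvg_mulmx (T : Type) (F : set_system T) (FF : Filter F) m n p
    (f : T -> 'M[R]_(m, n)) (g : T -> 'M[R]_(n, p))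
    (M : 'M[R]_(m, n)) (N : 'M[R]_(n, p)) :
  f @ F --> M -> g @ F --> N -> (fun t => f t *m g t) @ F --> M *m N.
Proof.
move=> fM gN; apply: cvg_mx => i j.
rewrite mxE; under eq_fun do rewrite mxE.
apply: cvg_big => [|k _]; first exact: add_continuous.
by apply: cvgM; exact: cvg_coord.
Qed.

Lemma cvg_trmx (T : Type) (F : set_system T) (FF : Filter F) m n
    (f : T -> 'M[R]_(m, n)) (M : 'M[R]_(m, n)) :
  f @ F --> M -> (fun t => (f t)^T) @ F --> M^T.
Proof.
move=> fM; apply: cvg_mx => i j.
by rewrite mxE; under eq_fun do rewrite mxE; exact: cvg_coord.
Qed.

End MatrixContinuity.

Definition frob (R : realType) (m n : nat) (A : 'M[R]_(m, n)) : R :=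
  Num.sqrt (\tr (A^T *m A)).

(* Rows and columns of the infinite matrices are numbered from 0. *)
Record infmx (R : realType) := InfMx {
  infmx_fun :> nat -> nat -> R;
  infmx_finite : exists n, forall k l, (n <= k)%N || (n <= l)%N -> infmx_fun k l = 0 }.

HB.instance Definition _ (R : realType) := gen_eqMixin (infmx R).
HB.instance Definition _ (R : realType) := gen_choiceMixin (infmx R).

Section InfiniteMatrices.
Context {R : realType}.

Lemma infmxP (A B : infmx R) : (forall k l, A k l = B k l) -> A = B.
Proof.
case: A B => [f hf] [g hg] /= fg.
have e : f = g by apply/funext => k; apply/funext => l.
by subst g; congr InfMx; exact: Prop_irrelevance.
Qed.

Definition pad_fun n (A : 'M[R]_n) (k l : nat) : R :=
  if insub k is Some i then if insub l is Some j then A i j else 0 else 0.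

Lemma pad_finite n (A : 'M[R]_n) :
  exists n, forall k l, (n <= k)%N || (n <= l)%N -> pad_fun A k l = 0.
Proof.
exists n => k l; rewrite /pad_fun; case: insubP => //= i kn _.
by case: insubP => //= j ln _; rewrite leqNgt kn leqNgt ln.
Qed.

Definition pad n (A : 'M[R]_n) : infmx R := InfMx (pad_finite A).

(* The direct limit topology of R^{oo x oo}, the union of the R^{n x n}. *)
Definition infmx_open (O : set (infmx R)) : Prop :=
  forall n, open (@pad n @^-1` O).

Lemma infmx_openT : infmx_open setT.
Proof. by move=> n; rewrite preimage_setT; exact: openT. Qed.

Lemma infmx_openI : setI_closed infmx_open.
Proof. by move=> O P oO oP n; rewrite preimage_setI; exact: openI. Qed.

Lemma infmx_open_bigU (I : Type) (f : I -> set (infmx R)) :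
  (forall i, infmx_open (f i)) -> infmx_open (\bigcup_i f i).
Proof. by move=> of_ n; rewrite preimage_bigcup; apply: bigcup_open => i _; exact: of_. Qed.

HB.instance Definition _ := isOpenTopological.Build (infmx R)
  infmx_openT infmx_openI infmx_open_bigU.

End InfiniteMatrices.

Section Grassmannians.
Context {R : realType}.

Definition Gr_fin (d n : nat) : set 'M[R]_n :=
  [set A | [/\ A = A^T, A = A *m A & \rank A = d]].
Arguments Gr_fin : clear implicits.

Definition Gr (d : nat) : set (infmx R) :=
  [set A | exists n (P : 'M[R]_n), Gr_fin d n P /\ A = pad P].

(* An element of R^{oo x oo} and an element of Gr(d) always lie in a common
   R^{n x n}, where the Frobenius distance is computed. *)
Definition Gr_thick (d : nat) (e : \bar R) : set (infmx R) :=
  if e == 0%E then Gr d else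
  [set A | exists n (M P : 'M[R]_n),
    [/\ A = pad M, Gr_fin d n P & ((frob (M - P))%:E < e)%E]].

Lemma frob0 m n : frob (0 : 'M[R]_(m, n)) = 0.
Proof. by rewrite /frob mulmx0 mxtrace0 sqrtr0. Qed.

Lemma Gr_thick_sub d (a b : \bar R) : (0 <= a)%E -> (a <= b)%E ->
  Gr_thick d a `<=` Gr_thick d b.
Proof.
move=> a0 ab A; rewrite /Gr_thick; case: (eqVneq a 0%E) => [_|an0]; last first.
  have -> : (b == 0%E) = false.
    by apply/negbTE/eqP => b0; move/eqP: an0; apply; apply/eqP;
      rewrite eq_le a0 -b0 ab.
  by move=> [n [M [P [-> gP lt]]]]; exists n, M, P; split=> //; exact: lt_le_trans lt ab.
case: (eqVneq b 0%E) => [//|bn0] [n [P [gP ->]]]; exists n, P, P; split=> //.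
by rewrite subrr frob0 lt_neqAle eq_sym bn0 (le_trans a0 ab).
Qed.

Lemma Gr_thick_addr d (e del : \bar R) : (0 <= e)%E -> (0 <= del)%E ->
  Gr_thick d ((Num.sqrt 2)%:E * e)%E `<=`
  Gr_thick d ((Num.sqrt 2)%:E * (e + del))%E.
Proof.
move=> e0 d0; apply: Gr_thick_sub.
  by apply: mule_ge0 => //; rewrite lee_fin sqrtr_ge0.
by apply: lee_wpmul2l; [rewrite lee_fin sqrtr_ge0|exact: leeDl].
Qed.

Lemma Gr_thick_double d (e : \bar R) : (0 <= e)%E ->
  Gr_thick d ((Num.sqrt 2)%:E * e)%E `<=`
  Gr_thick d ((2 * Num.sqrt 2)%:E * e)%E.
Proof.
move=> e0; apply: Gr_thick_sub.
  by apply: mule_ge0 => //; rewrite lee_fin sqrtr_ge0.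
apply: lee_wpmul2r => //; rewrite lee_fin.
by rewrite ler_peMl ?sqrtr_ge0// ler1n.
Qed.

End Grassmannians.
Arguments Gr_fin {R} d n.

Section GrTopology.
Context {R : realType}.

Lemma padE n (A : 'M[R]_n) (i j : 'I_n) : pad A i j = A i j.
Proof. by rewrite /= /pad_fun !valK. Qed.

Lemma pad_out n (A : 'M[R]_n) k l : (n <= k)%N || (n <= l)%N -> pad A k l = 0.
Proof.
rewrite /= /pad_fun; case: insubP => //= i kn _.
by case: insubP => //= j ln _; rewrite leqNgt kn leqNgt ln.
Qed.

Lemma mxtrace_idem n (P : 'M[R]_n) : P = P *m P -> \tr P = (\rank P)%:R.
Proof.
move=> PP; have e : row_base P *m col_base P = 1%:M.
  apply: (row_full_inj (col_base_full P)); rewrite /= mulmx1.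
  apply: (row_free_inj (row_base_free P)); rewrite /= mulmxA mulmx_base.
  by rewrite -mulmxA mulmx_base -PP.
by rewrite -{1}(mulmx_base P) mxtrace_mulC e mxtrace1.
Qed.

Lemma sum_widen n N (f : nat -> R) : (n <= N)%N ->
  (forall k, (n <= k)%N -> f k = 0) -> \sum_(k < n) f k = \sum_(k < N) f k.
Proof.
move=> nN f0; rewrite (big_ord_widen N f nN) [RHS](bigID (fun k : 'I_N => (k < n)%N))/=.
by rewrite [X in _ + X]big1 ?addr0// => k; rewrite -leqNgt => /f0.
Qed.

Lemma Gr_fin_pad d n m (A : 'M[R]_n) (P : 'M[R]_m) :
  pad A = pad P -> Gr_fin d m P -> Gr_fin d n A.
Proof.
move=> AP [PT PP rP].
have APE k l : pad A k l = pad P k l by rewrite AP.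
have sq (q : nat) (M : 'M[R]_q) k l : M = M *m M ->
    pad M k l = \sum_(i < q) pad M k i * pad M i l.
  move=> MM; have [|] := boolP ((q <= k) || (q <= l))%N.
    move=> o; rewrite pad_out// big1// => i _.
    case/orP: o => o; first by rewrite (@pad_out _ _ k) ?o// mul0r.
    by rewrite (@pad_out _ _ i l) ?o ?orbT// mulr0.
  rewrite negb_or -!ltnNge => /andP[kq lq].
  rewrite -[k]/(nat_of_ord (Ordinal kq)) -[l]/(nat_of_ord (Ordinal lq)).
  by rewrite padE {1}MM mxE; apply: eq_bigr => i _; rewrite !padE.
have AA : A = A *m A.
  apply/matrixP => i j; rewrite -padE APE sq// mxE.
  under [RHS]eq_bigr do rewrite -!padE !APE.
  pose f k := pad P i k * pad P k j.
  rewrite (@sum_widen m (m + n) f) ?leq_addr//; last first.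
    by move=> k mk; rewrite /f pad_out ?mul0r ?mk ?orbT.
  rewrite (@sum_widen n (m + n) f) ?leq_addl// => k nk.
  by rewrite /f -APE pad_out ?mul0r ?nk ?orbT.
split=> //.
  apply/matrixP => i j; rewrite mxE -!padE !APE.
  rewrite /= /pad_fun; case: insubP => [a _ _|_]; case: insubP => // b _ _.
  by rewrite PT mxE -PT.
apply/eqP; rewrite -(eqr_nat R) -mxtrace_idem// -rP -mxtrace_idem//; apply/eqP.
rewrite /mxtrace; pose f k := pad P k k.
rewrite (eq_bigr (fun i : 'I_n => f i)); last by move=> i _; rewrite -padE APE.
rewrite [RHS](eq_bigr (fun i : 'I_m => f i)); last by move=> i _; rewrite -padE.
rewrite (@sum_widen m (m + n) f) ?leq_addr//; last first.
  by move=> k mk; rewrite /f pad_out ?mk.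
rewrite (@sum_widen n (m + n) f) ?leq_addl// => k nk.
by rewrite /f -APE pad_out ?nk.
Qed.

Lemma preimage_Gr d n : @pad R n @^-1` Gr d = Gr_fin d n.
Proof.
apply/seteqP; split=> A; last by move=> gA; exists n, A.
by move=> [m [P [gP e]]]; exact: Gr_fin_pad e gP.
Qed.

Lemma closed_eq_mx n (f : 'M[R]_n -> 'M[R]_n) : continuous f ->
  closed [set A | A = f A].
Proof.
move=> cf.
have -> : [set A | A = f A] =
    \bigcap_(p in [set: 'I_n * 'I_n]) [set A : 'M[R]_n | A p.1 p.2 - f A p.1 p.2 = 0].
  apply/seteqP; split=> [A /= e p _|A e]; first by rewrite /= -e subrr.
  by apply/matrixP => i j; apply/eqP; rewrite -subr_eq0; apply/eqP; exact: (e (i, j)).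
apply: closed_bigI => -[i j] _.
have c : continuous (fun A : 'M[R]_n => A i j - f A i j).
  move=> A; apply: (@cvgB R R _ (nbhs A)); first exact: (@coord_continuous R n n i j A).
  exact: (cvg_comp f (fun N => N i j) (cf A) (@coord_continuous _ _ _ i j (f A))).
by apply: (@preimage_closed _ _ _ [set 0] (in1W c)); exact: closed_eq.
Qed.

Lemma closed_Gr_fin d n : closed (Gr_fin d n : set 'M[R]_n).
Proof.
have -> : (Gr_fin d n : set 'M[R]_n) =
    [set A : 'M[R]_n | A = A^T] `&` [set A : 'M[R]_n | A = A *m A] `&`
    [set A : 'M[R]_n | \tr A = d%:R].
  apply/seteqP; split=> A.
    by move=> [AT AA rA]; split; [split|rewrite /= mxtrace_idem// rA].
  move=> [[AT AA] /= tA]; split=> //; apply/eqP.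
  by rewrite -(eqr_nat R) -mxtrace_idem// tA.
apply: closedI; first apply: closedI.
- by apply: closed_eq_mx => A; exact: (@cvg_trmx R _ (nbhs A) _ _ _ id A (@cvg_id _ (nbhs A))).
- by apply: closed_eq_mx => A; exact: (@cvg_mulmx R _ (nbhs A) _ _ _ _ id id A A (@cvg_id _ (nbhs A)) (@cvg_id _ (nbhs A))).
- have c : continuous (fun A : 'M[R]_n => \tr A).
    apply: continuous_big => [|i _]; first exact: add_continuous.
    exact: (@coord_continuous R).
  have -> : [set A : 'M[R]_n | \tr A = d%:R] = mxtrace @^-1` [set d%:R] by [].
  by apply: preimage_closed (in1W c) _; exact: closed_eq.
Qed.

(* The topology that Gr(d) inherits from R^{oo x oo} is the direct limit
   topology of the Gr(d, n), so Gr_thick d 0 has the intended topology. *)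
Lemma Gr_direct_limit (d : nat) (S : set (infmx R)) : S `<=` Gr d ->
  (exists2 O, open O & S = O `&` Gr d) <->
  (forall n, exists2 O : set 'M[R]_n, open O & @pad R n @^-1` S = O `&` Gr_fin d n).
Proof.
move=> Sd; split=> [[W oW ->] n|h].
  by exists (@pad R n @^-1` W); [exact: oW|rewrite preimage_setI preimage_Gr].
exists (~` (Gr d `\` S)).
  move=> n; have [W oW e] := h n.
  rewrite setCD preimage_setU -preimage_setC preimage_Gr e setUIr setvU setIT.
  by apply: openU => //; apply: closed_openC; exact: closed_Gr_fin.
by rewrite setCD setIUl setICl set0U; apply/esym/setIidl.
Qed.

End GrTopology.

Definition orthogonal_group (R : realType) (d : nat) : set 'M[R]_d :=
  [set A | A^T *m A = 1%:M].

(* "norm of A - C less than e", read as A = C when e = 0. *)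
Definition approx_eq (R : realType) (d : nat) (e : \bar R) (A C : 'M[R]_d) : Prop :=
  if e == 0%E then A = C else ((frob (A - C))%:E < e)%E.

(* The maps are total functions on B of which only the values on the
   intersections matter: two cochains that agree there are identified in H1.
   Membership in the nerve is implied by the given point y. *)
Record Z1 (R : realType) (B : topologicalType) (I : Type) (U : I -> set B)
    (d : nat) (e : \bar R) := Cocycle {
  Z1_fun :> I -> I -> B -> 'M[R]_d;
  Z1_orthogonal : forall i j y, (U j `&` U i) y ->
    orthogonal_group (Z1_fun i j y);
  Z1_continuous : forall i j, {within U j `&` U i, continuous (Z1_fun i j)};
  Z1_inv : forall i j y, (U j `&` U i) y ->
    Z1_fun i j y = invmx (Z1_fun j i y);
  Z1_approx : forall i j k y, (U k `&` U j `&` U i) y ->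
    approx_eq e (Z1_fun i j y *m Z1_fun j k y) (Z1_fun i k y) }.
Arguments Z1 R {B I} U d e.

HB.instance Definition _ (R : realType) (B : topologicalType) (I : Type)
  (U : I -> set B) (d : nat) (e : \bar R) := gen_eqMixin (Z1 R U d e).
HB.instance Definition _ (R : realType) (B : topologicalType) (I : Type)
  (U : I -> set B) (d : nat) (e : \bar R) := gen_choiceMixin (Z1 R U d e).

Section Cohomology.
Context {R : realType} {B : topologicalType} {I : Type} (U : I -> set B).
Context (d : nat) (e : \bar R).

Definition is_gauge (Th : I -> B -> 'M[R]_d) : Prop :=
  (forall i, {within U i, continuous (Th i)}) /\
  (forall i y, U i y -> orthogonal_group (Th i y)).

Definition gauge_equiv (Om La : Z1 R U d e) : Prop :=
  exists2 Th, is_gauge Th &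
    forall i j y, (U j `&` U i) y ->
      La i j y = Th i y *m Om i j y *m invmx (Th j y).

Lemma orthogonal_mulV (A : 'M[R]_d) : orthogonal_group A -> A *m A^T = 1%:M.
Proof. exact: mulmx1C. Qed.

Lemma orthogonal_unit (A : 'M[R]_d) : orthogonal_group A -> A \in unitmx.
Proof. by move=> /mulmx1_unit[]. Qed.

Lemma orthogonal_mul (A C : 'M[R]_d) :
  orthogonal_group A -> orthogonal_group C -> orthogonal_group (A *m C).
Proof.
move=> oA oC; have : C^T *m (A^T *m A) *m C = 1%:M by rewrite oA mulmx1.
by rewrite /orthogonal_group/= trmx_mul !mulmxA.
Qed.

Lemma gauge_refl Om : gauge_equiv Om Om.
Proof.
exists (fun _ _ => 1%:M).
  split=> [i|i y _]; first by apply: continuous_subspaceT => x; exact: cvg_cst.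
  by rewrite /orthogonal_group/= trmx1 mulmx1.
by move=> i j y _; rewrite invmx1 mulmx1 mul1mx.
Qed.

Lemma gauge_sym Om La : gauge_equiv Om La -> gauge_equiv La Om.
Proof.
move=> [Th [cT oT] eq]; exists (fun i y => (Th i y)^T).
  split=> [i x|i y Uy]; first by apply: cvg_trmx; exact: cT.
  by rewrite /orthogonal_group/= trmxK; exact/orthogonal_mulV/oT.
move=> i j y [Uj Ui].
have oi := oT _ _ Ui; have oj := oT _ _ Uj.
rewrite eq// !mulmxA oi mul1mx -!mulmxA.
have -> : invmx (Th j y)^T = Th j y.
  have u : (Th j y)^T \in unitmx by rewrite unitmx_tr orthogonal_unit.
  apply: (can_inj (mulKmx u)).
  by rewrite mulmxV ?unitmx_tr ?orthogonal_unit.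
by rewrite mulVmx ?mulmx1// orthogonal_unit.
Qed.

Lemma gauge_trans La Om Ga :
  gauge_equiv Om La -> gauge_equiv La Ga -> gauge_equiv Om Ga.
Proof.
move=> [T1 [c1 o1] e1] [T2 [c2 o2] e2]; exists (fun i y => T2 i y *m T1 i y).
  split=> [i x|i y Uy]; first by apply: cvg_mulmx; [exact: c2|exact: c1].
  by apply: orthogonal_mul; [exact: o2|exact: o1].
move=> i j y [Uj Ui]; rewrite e2// e1// !mulmxA -!mulmxA; congr (_ *m (_ *m (_ *m _))).
have u1 := orthogonal_unit (o1 _ _ Uj); have u2 := orthogonal_unit (o2 _ _ Uj).
have u : T2 j y *m T1 j y \in unitmx by rewrite unitmx_mul u1 u2.
apply: (can_inj (mulKmx u)).
by rewrite -mulmxA mulKVmx// !mulmxV.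
Qed.

Definition gauge_equivb (Om La : Z1 R U d e) : bool := `[< gauge_equiv Om La >].

Lemma gauge_equivb_equiv : equiv_class_of gauge_equivb.
Proof.
split=> [f|f g|g f h]; first by apply/asboolP; exact: gauge_refl.
  by apply/asbool_equiv_eq; split; exact: gauge_sym.
by move=> /asboolP fg /asboolP gh; apply/asboolP; exact: gauge_trans fg gh.
Qed.

Canonical gauge_equivb_equiv_rel := EquivRelPack gauge_equivb_equiv.

Definition H1 := {eq_quot gauge_equivb}.

HB.instance Definition _ := Choice.on H1.
HB.instance Definition _ := EqQuotient.on H1.

Lemma H1P (Om La : Z1 R U d e) :
  \pi_H1 Om = \pi_H1 La <-> gauge_equiv Om La.
Proof. by split=> [/eqmodP/asboolP//|h]; apply/eqmodP/asboolP. Qed.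

(* 0 is added to the set because the supremum over the empty set must be 0. *)
Definition dZ (Om La : Z1 R U d e) : \bar R :=
  ereal_sup [set r | r = 0%E \/ exists i j y, (U j `&` U i) y /\
                       r = (frob (Om i j y - La i j y))%:E].

Definition dH (x z : H1) : \bar R :=
  ereal_inf [set r | exists Om La,
    [/\ \pi_H1 Om = x, \pi_H1 La = z & r = dZ Om La]].

End Cohomology.
Arguments H1 R {B I} U d e.

Section Refinements.
Context {R : realType} {B : topologicalType} {I J : Type}.
Context {U : I -> set B} {V : J -> set B} {d : nat} {e : \bar R}.

Definition refinement (nu : J -> I) : Prop := forall j, V j `<=` U (nu j).

Context (nu : J -> I) (hnu : refinement nu).

Lemma refinement_setI j k : V k `&` V j `<=` U (nu k) `&` U (nu j).
Proof. by move=> y [? ?]; split; exact: hnu. Qed.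

Lemma refinement_setI3 i j k y :
  (V k `&` V j `&` V i) y -> (U (nu k) `&` U (nu j) `&` U (nu i)) y.
Proof. by move=> [[? ?] ?]; split; [split|]; exact: hnu. Qed.

Definition Z1_refine (Om : Z1 R U d e) : Z1 R V d e :=
  @Cocycle R B J V d e (fun j k => Om (nu j) (nu k))
    (fun j k y h => @Z1_orthogonal _ _ _ _ _ _ Om _ _ _ (refinement_setI h))
    (fun j k => continuous_subspaceW (@refinement_setI j k)
                  (@Z1_continuous _ _ _ _ _ _ Om (nu j) (nu k)))
    (fun j k y h => @Z1_inv _ _ _ _ _ _ Om _ _ _ (refinement_setI h))
    (fun i j k y h => @Z1_approx _ _ _ _ _ _ Om _ _ _ _ (refinement_setI3 h)).

Definition H1_refine (x : H1 R U d e) : H1 R V d e :=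
  \pi_(H1 R V d e) (Z1_refine (repr x)).

Lemma H1_refineE Om :
  H1_refine (\pi_(H1 R U d e) Om) = \pi_(H1 R V d e) (Z1_refine Om).
Proof.
apply/H1P; have /H1P [Th [cT oT] eq] : \pi_(H1 R U d e) (repr (\pi_(H1 R U d e) Om))
  = \pi_(H1 R U d e) Om by rewrite reprK.
exists (fun j => Th (nu j)).
  split=> [j|j y /hnu]; last exact: oT.
  by apply: continuous_subspaceW (@hnu j) _; exact: cT.
by move=> i j y [Vj Vi]; apply: eq; split; exact: hnu.
Qed.

End Refinements.
Arguments refinement {B I J} U V nu.

Section ClassifyingMap.
Context {R : realType} {B : topologicalType} {I : countType} (U : I -> set B).
Context (d : nat) (e : \bar R).

Definition partition_of_unity (phi : I -> B -> R) : Prop :=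
  [/\ forall i, continuous (phi i),
      forall i y, 0 <= phi i y,
      forall i, closure [set y | phi i y != 0] `<=` U i,
      forall y : B, exists2 W, nbhs y W &
        finite_set [set i | [set z | phi i z != 0] `&` W !=set0]
    & forall y, \sum_(i \in [set: I]) phi i y = 1].

Definition index_injection (iota : I -> nat) : Prop :=
  injective iota /\ forall i, (0 < iota i)%N.

Context (phi : I -> B -> R) (iota : I -> nat) (Om : Z1 R U d e).

(* Entry (k, c) of the matrix Phi_i(y), which has infinitely many rows and d
   columns: row d * iota j + r is row r of sqrt(phi_j(y)) Omega_ij(y)^t, and
   phi_j(y) = 0 when y is not in U_j. *)
Definition frame (i : I) (y : B) (k : nat) (c : 'I_d) : R :=
  \sum_(j \in [set: I]) \sum_(r < d | k == (d * iota j + r)%N)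
    Num.sqrt (phi j y) * (Om i j y)^T r c.

(* Entry (k, l) of the sum over i of phi_i(y) Phi_i(y) Phi_i(y)^t. *)
Definition cl_entry (y : B) (k l : nat) : R :=
  \sum_(i \in [set: I]) phi i y * \sum_(c < d) frame i y k c * frame i y l c.

Definition cl_represents
    (h : hclasses R B (Gr_thick d ((Num.sqrt 2)%:E * e)%E)) : Prop :=
  exists2 f : map_into B (infmx R) (Gr_thick d ((Num.sqrt 2)%:E * e)%E),
    (forall y k l, f y k l = cl_entry y k l) & h = \pi f.

End ClassifyingMap.

(* F is the map cl': choices of phi and iota exist, and for every such choice
   the map built from Omega is a continuous map into Gr(d)^{sqrt 2 e} whose
   homotopy class is F Omega. *)
Definition is_cl' (R : realType) (B : topologicalType) (I : countType)
    (U : I -> set B) (d : nat) (e : \bar R)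
    (F : Z1 R U d e -> hclasses R B (Gr_thick d ((Num.sqrt 2)%:E * e)%E)) : Prop :=
  (exists (phi : I -> B -> R) (iota : I -> nat),
     partition_of_unity U phi /\ index_injection iota) /\
  forall (phi : I -> B -> R) (iota : I -> nat),
    partition_of_unity U phi -> index_injection iota ->
    forall Om : Z1 R U d e, cl_represents phi iota Om (F Om).

(* Main.v *)
Require Import Defs.
From HB Require Import structures.
From mathcomp Require Import all_boot all_order all_algebra generic_quotient.
From mathcomp Require Import finmap all_classical all_reals all_analysis.
From mathcomp Require Import ring lra.
Set Implicit Arguments.
Unset Strict Implicit.
Unset Printing Implicit Defensive.
Import Order.TTheory GRing.Theory Num.Theory.
Import numFieldNormedType.Exports.
Local Open Scope classical_set_scope.
Local Open Scope ring_scope.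
Local Open Scope quotient_scope.

(* At each point only finitely many indices a carry a weight phi_a <> 0, and the
   classifying matrix is the convex combination of the projections
   Phi_a Phi_a^t. Since |X X^t - Y Y^t| <= sqrt 2 |X - Y| for orthonormal frames
   X and Y, applied to X = Phi_a Omega_ab and Y = Phi_b, it is within sqrt 2 e of
   each of them.

   For a cocycle on a disjoint union of two covers, a partition of unity on
   either half is subordinate to the whole, and moving the weights from one half
   to the other is a homotopy between the classifying maps of the two restricted
   cocycles. The blocks may share positions as long as no two indices with
   nonzero weight at the same point and time do. All the invariance statements
   are instances: the two halves carry a cocycle and its gauge transform, two
   cochains at distance < delta (which together form an (e + delta)-cocycle), or
   the pullbacks along two refinements. The last instance even gives a homotopy
   within Gr^{sqrt 2 e}. *)

(** * Frobenius norm and convex combinations of projections *)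

Section Frobenius.
Context {R : realType}.
Implicit Types m n p d : nat.

Lemma gram_ge0 m n (A : 'M[R]_(m, n)) : 0 <= \tr (A^T *m A).
Proof.
rewrite sumr_ge0// => i _; rewrite mxE sumr_ge0// => k _.
by rewrite mxE -expr2 sqr_ge0.
Qed.

Lemma frob_ge0 m n (A : 'M[R]_(m, n)) : 0 <= frob A.
Proof. exact: sqrtr_ge0. Qed.

Lemma frob_sqr m n (A : 'M[R]_(m, n)) : frob A ^+ 2 = \tr (A^T *m A).
Proof. by rewrite sqr_sqrtr// gram_ge0. Qed.

Lemma mxtrace_gramC m n (A C : 'M[R]_(m, n)) : \tr (C^T *m A) = \tr (A^T *m C).
Proof. by rewrite -mxtrace_tr trmx_mul trmxK. Qed.

Lemma frob_sqrD m n (A C : 'M[R]_(m, n)) :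
  frob (A + C) ^+ 2 = frob A ^+ 2 + 2 * \tr (A^T *m C) + frob C ^+ 2.
Proof.
rewrite !frob_sqr [(A + C)^T]linearD/= mulmxDl !mulmxDr !mxtraceD.
by rewrite (mxtrace_gramC A C); ring.
Qed.

Lemma frobZ m n c (A : 'M[R]_(m, n)) : frob (c *: A) = `|c| * frob A.
Proof.
rewrite /frob [(_ *: _)^T]linearZ/= -scalemxAl -scalemxAr !mxtraceZ mulrA -expr2.
by rewrite sqrtrM ?sqr_ge0// sqrtr_sqr.
Qed.

Lemma frobN m n (A : 'M[R]_(m, n)) : frob (- A) = frob A.
Proof. by rewrite -scaleN1r frobZ normrN1 mul1r. Qed.

Lemma frob_eq0 m n (A : 'M[R]_(m, n)) : frob A = 0 -> A = 0.
Proof.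
move=> A0; have : \tr (A^T *m A) = 0 by rewrite -frob_sqr A0 expr0n.
move=> /psumr_eq0P h; apply/matrixP => i j; rewrite mxE.
have /h : forall k, true -> 0 <= (A^T *m A) k k.
  by move=> k _; rewrite mxE sumr_ge0// => l _; rewrite mxE -expr2 sqr_ge0.
move=> /(_ j isT); rewrite mxE => /psumr_eq0P g.
have /g : forall l, true -> 0 <= A^T j l * A l j.
  by move=> l _; rewrite mxE -expr2 sqr_ge0.
by move=> /(_ i isT)/eqP; rewrite mxE -expr2 sqrf_eq0 => /eqP.
Qed.

Lemma frob_cauchy_schwarz m n (A C : 'M[R]_(m, n)) :
  \tr (A^T *m C) <= frob A * frob C.
Proof.
have [/frob_eq0 ->|A0] := eqVneq (frob A) 0.
  by rewrite trmx0 mul0mx mxtrace0 frob0 mul0r.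
have [/frob_eq0 ->|C0] := eqVneq (frob C) 0.
  by rewrite mulmx0 mxtrace0 frob0 mulr0.
have Ap : 0 < frob A by rewrite lt_neqAle eq_sym A0 frob_ge0.
have Cp : 0 < frob C by rewrite lt_neqAle eq_sym C0 frob_ge0.
(* Expanding this square gives |A| |C| (|A| |C| - t) >= 0 up to a factor 2, and both norms are
   positive here. *)
have := sqr_ge0 (frob (frob C *: A + (- frob A) *: C)).
rewrite frob_sqrD !frobZ normrN !ger0_norm ?frob_ge0//.
rewrite [(_ *: _)^T]linearZ/= -scalemxAl -scalemxAr !mxtraceZ.
set t := \tr _ => h.
rewrite -subr_ge0 -(pmulr_rge0 _ (mulr_gt0 Ap Cp)); nra.
Qed.

Lemma frobD m n (A C : 'M[R]_(m, n)) : frob (A + C) <= frob A + frob C.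
Proof.
rewrite -(@ler_pXn2r _ 2) ?nnegrE ?addr_ge0 ?frob_ge0// frob_sqrD sqrrD.
by rewrite lerD2r lerD2l mulr_natl lerMn2r frob_cauchy_schwarz orbT.
Qed.

Lemma frob_sum m n (I : Type) (r : seq I) (P : pred I) (F : I -> 'M[R]_(m, n)) :
  frob (\sum_(i <- r | P i) F i) <= \sum_(i <- r | P i) frob (F i).
Proof.
elim/big_rec2: _ => [|i x A _ le]; first by rewrite frob0.
by apply: le_trans (frobD _ _) _; rewrite lerD2l.
Qed.

Lemma frob_mulmxl m n p (O : 'M[R]_(m, n)) (A : 'M[R]_(n, p)) :
  O^T *m O = 1%:M -> frob (O *m A) = frob A.
Proof. by move=> h; rewrite /frob trmx_mul mulmxA -(mulmxA A^T) h mulmx1. Qed.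

Lemma frob_mulmxr m n p (A : 'M[R]_(m, n)) (O : 'M[R]_(n, p)) :
  O *m O^T = 1%:M -> frob (A *m O) = frob A.
Proof.
move=> h; rewrite /frob trmx_mul -mulmxA mxtrace_mulC -!mulmxA h mulmx1.
by rewrite mxtrace_mulC mxtrace_mulC.
Qed.

(* Expanding |X^t Y - 1|^2 >= 0 gives the bound. *)
Lemma frob_proj_le n d (X Y : 'M[R]_(n, d)) :
  X^T *m X = 1%:M -> Y^T *m Y = 1%:M ->
  frob (X *m X^T - Y *m Y^T) <= Num.sqrt 2 * frob (X - Y).
Proof.
move=> XX YY; rewrite -(@ler_pXn2r _ 2) ?nnegrE ?mulr_ge0 ?frob_ge0 ?sqrtr_ge0//.
rewrite exprMn (@sqr_sqrtr _ (2 : R))//.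
have e p q (A C : 'M[R]_(p, q)) :
    frob (A - C) ^+ 2 = frob A ^+ 2 - 2 * \tr (A^T *m C) + frob C ^+ 2.
  by rewrite frob_sqrD frobN mulmxN raddfN mulrN.
have pr (Z : 'M[R]_(n, d)) : Z^T *m Z = 1%:M -> frob (Z *m Z^T) ^+ 2 = d%:R.
  move=> ZZ; rewrite frob_sqr trmx_mul trmxK mulmxA -(mulmxA Z) ZZ mulmx1.
  by rewrite mxtrace_mulC ZZ mxtrace1.
rewrite !e !pr// !frob_sqr XX YY mxtrace1 trmx_mul trmxK.
have := sqr_ge0 (frob (X^T *m Y - 1%:M)); rewrite e !frob_sqr mulmx1 trmx1 mulmx1.
rewrite mxtrace_tr mxtrace1.
have -> : \tr (X *m X^T *m (Y *m Y^T)) = \tr ((X^T *m Y)^T *m (X^T *m Y)).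
  by rewrite trmx_mul trmxK mulmxA mxtrace_mulC !mulmxA.
move=> h; lra.
Qed.

End Frobenius.

(** * Frames built from orthogonal blocks *)

Section BlockFrames.
Context {R : realType} (T : finType) (n d : nat).
Context (w : T -> R) (E : T -> 'M[R]_(n, d)).
Hypothesis w_gt0 : forall a, 0 < w a.
Hypothesis w_sum : \sum_a w a = 1.
Hypothesis E_orthonormal : forall a b, (E a)^T *m E b = (a == b)%:R%:M.

(** [E a] plays the role of the inclusion of R^d as block a, so this is the matrix whose block a is
    sqrt(w_a) X_a. The orthogonality relations of [E] stand in for all bookkeeping of row
    numbers. *)
Definition block_comb (X : T -> 'M[R]_d) : 'M[R]_(n, d) :=
  \sum_a Num.sqrt (w a) *: (E a *m X a).

(** Cross terms vanish because distinct blocks are orthogonal, and on each block the two square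
    roots multiply to w_a. Hence frames are orthonormal and squared distances between them are
    weighted averages. *)
Lemma block_comb_gram (X Y : T -> 'M[R]_d) :
  (block_comb X)^T *m block_comb Y = \sum_a w a *: ((X a)^T *m Y a).
Proof.
rewrite /block_comb [(\sum_a _)^T]linear_sum/= mulmx_suml; apply: eq_bigr => a _.
rewrite mulmx_sumr (bigD1 a)//= big1 => [|b ba]; last first.
  rewrite [(_ *: _)^T]linearZ/= trmx_mul -scalemxAl -scalemxAr.
  rewrite -mulmxA (mulmxA (E a)^T) E_orthonormal eq_sym (negbTE ba).
  by rewrite mul_scalar_mx scale0r mulmx0 !scaler0.
rewrite addr0 [(_ *: _)^T]linearZ/= trmx_mul -scalemxAl -scalemxAr scalerA.
rewrite -expr2 sqr_sqrtr ?ltW//.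
by rewrite -mulmxA (mulmxA (E a)^T) E_orthonormal eqxx mul1mx.
Qed.

Lemma block_comb_mulr (X : T -> 'M[R]_d) (A : 'M[R]_d) :
  block_comb X *m A = block_comb (fun a => X a *m A).
Proof.
by rewrite /block_comb mulmx_suml; apply: eq_bigr => a _; rewrite -scalemxAl mulmxA.
Qed.

Lemma block_combB (X Y : T -> 'M[R]_d) :
  block_comb X - block_comb Y = block_comb (fun a => X a - Y a).
Proof.
by rewrite /block_comb -sumrB; apply: eq_bigr => a _; rewrite -scalerBr -mulmxBr.
Qed.

Context (e : \bar R) (O : T -> T -> 'M[R]_d).
Hypothesis O_orthogonal : forall a b, (O a b)^T *m O a b = 1%:M.
Hypothesis O_approx : forall a b c, approx_eq e (O a b *m O b c) (O a c).

(** In the application [O b a] is the transpose of [O a b], so this is the frame Phi_a of the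
    construction. *)
Let Phi a := block_comb (fun b => O b a).

Let Phi_orthonormal a : (Phi a)^T *m Phi a = 1%:M.
Proof.
rewrite block_comb_gram; under eq_bigr do rewrite O_orthogonal.
by rewrite -scaler_suml w_sum scale1r.
Qed.

Let Gr_Phi a : Gr_fin d n (Phi a *m (Phi a)^T).
Proof.
have idem : Phi a *m (Phi a)^T = Phi a *m (Phi a)^T *m (Phi a *m (Phi a)^T).
  by rewrite !mulmxA -(mulmxA (Phi a)) Phi_orthonormal mulmx1.
split=> //; first by rewrite trmx_mul trmxK.
apply/eqP; rewrite -(eqr_nat R) -mxtrace_idem// mxtrace_mulC Phi_orthonormal.
by rewrite mxtrace1.
Qed.

(** Rotating a frame by an orthogonal matrix does not change the projection onto its span. This
    replaces Phi_a by Phi_a O_ab, which is close to Phi_b. *)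
Let rotate a b : block_comb (fun c => O c a *m O a b) *m
  (block_comb (fun c => O c a *m O a b))^T = Phi a *m (Phi a)^T.
Proof.
rewrite -block_comb_mulr trmx_mul mulmxA -(mulmxA _ (O a b)).
by rewrite (mulmx1C (O_orthogonal a b)) mulmx1.
Qed.

Lemma Gr_thick_block_comb : (0 <= e)%E ->
  Gr_thick d ((Num.sqrt 2)%:E * e)%E
    (pad (\sum_a w a *: (Phi a *m (Phi a)^T))).
Proof.
(* Weights with sum 1 force an index to exist; its projection is the nearby point of the
   Grassmannian. It also supplies the term that strict inequalities between sums require. *)
move=> e0; have [b0 _] : exists b : T, true.
  apply/not_existsP => h; have := w_sum; rewrite big1 => [/esym/eqP|a _].
    by rewrite oner_eq0.
  by have := h a.
have s2 : 0 < Num.sqrt 2 :> R by rewrite sqrtr_gt0.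
have split_b0 : \sum_a w a *: (Phi a *m (Phi a)^T) - Phi b0 *m (Phi b0)^T =
    \sum_a w a *: (Phi a *m (Phi a)^T - Phi b0 *m (Phi b0)^T).
  rewrite -{1}[Phi b0 *m _]scale1r -w_sum scaler_suml -sumrB.
  by apply: eq_bigr => a _; rewrite scalerBr.
rewrite /Gr_thick mule_eq0 eqe gt_eqF//= ; have [ez|enz] := eqVneq e 0%E.
  exists n, (Phi b0 *m (Phi b0)^T); split=> //; congr pad; apply/eqP.
  (* For e = 0 the rotated frame Phi_a O_ab0 equals Phi_b0, so all the projections coincide. *)
  rewrite -subr_eq0 split_b0 big1// => a _; rewrite -(rotate a b0).
  have -> : block_comb (fun c => O c a *m O a b0) = Phi b0.
    rewrite /block_comb; apply: eq_bigr => c _; congr (_ *: (_ *m _)).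
    by have := O_approx c a b0; rewrite /approx_eq ez eqxx.
  by rewrite subrr scaler0.
exists n, (\sum_a w a *: (Phi a *m (Phi a)^T)), (Phi b0 *m (Phi b0)^T); split=> //.
(* For e = +oo every finite distance is admissible; the remaining case is a real radius r. *)
case: e e0 enz O_approx => [r| |//] e0 enz Oa; last first.
  by rewrite gt0_muley ?lte_fin// ltry.
rewrite -EFinM lte_fin split_b0; apply: le_lt_trans (frob_sum _ _ _) _.
have Oa' a b c : frob (O a b *m O b c - O a c) < r.
  by have := Oa a b c; rewrite /approx_eq (negbTE enz) lte_fin.
have r0 : 0 < r by apply: le_lt_trans (Oa' b0 b0 b0); exact: frob_ge0.
have -> : Num.sqrt 2 * r = \sum_a w a * (Num.sqrt 2 * r).
  by rewrite -mulr_suml w_sum mul1r.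
apply: ltr_sum => [|a _]; first by apply/hasP; exists b0; rewrite ?mem_index_enum.
rewrite frobZ ger0_norm ?ltW// ltr_pM2l// -(rotate a b0).
have X1 : (block_comb (fun c => O c a *m O a b0))^T *m
    block_comb (fun c => O c a *m O a b0) = 1%:M.
  rewrite -block_comb_mulr trmx_mul mulmxA -(mulmxA _ (Phi a)^T) Phi_orthonormal.
  by rewrite mulmx1 O_orthogonal.
apply: le_lt_trans (frob_proj_le X1 (Phi_orthonormal b0)) _.
rewrite ltr_pM2l// -(@ltr_pXn2r _ 2) ?nnegrE ?frob_ge0 ?ltW//.
(* The squared distance between the two frames is the average over c of |O_ca O_ab0 - O_cb0|^2, and
   each term is below r^2. *)
rewrite frob_sqr block_combB block_comb_gram raddf_sum/=.
have -> : r ^+ 2 = \sum_a w a * r ^+ 2 by rewrite -mulr_suml w_sum mul1r.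
apply: ltr_sum => [|c _]; first by apply/hasP; exists b0; rewrite ?mem_index_enum.
rewrite mxtraceZ ltr_pM2l// -frob_sqr.
by rewrite ltr_pXn2r ?nnegrE ?frob_ge0 ?ltW//; exact: Oa'.
Qed.

End BlockFrames.

(** * Continuity of the classifying map *)

(** Entrywise continuity is too weak for the direct limit topology. The uniform local bound makes
    the map factor near x through a single R^{n x n}, where it is continuous, followed by [pad]. *)
Lemma continuous_infmx (R : realType) (X : topologicalType) (f : X -> infmx R) :
  (forall k l, continuous (fun x => f x k l)) ->
  (forall x : X, exists n, \forall z \near x, forall k l,
     (n <= k)%N || (n <= l)%N -> f z k l = 0) ->
  continuous f.
Proof.
move=> cf bf x; have [n nf] := bf x.
pose M z : 'M[R]_n := \matrix_(i, j) f z i j.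
have fM z : (forall k l, (n <= k)%N || (n <= l)%N -> f z k l = 0) -> f z = pad (M z).
  move=> fz; apply: infmxP => k l; have [kl|] := boolP ((n <= k)%N || (n <= l)%N).
    by rewrite fz// pad_out.
  rewrite negb_or -!ltnNge => /andP[kn ln].
  by rewrite -[k]/(val (Ordinal kn)) -[l]/(val (Ordinal ln)) padE mxE.
have cM : M @ x --> M x.
  by apply: cvg_mx => i j; rewrite mxE; under eq_fun do rewrite mxE; exact: cf.
move=> O; rewrite nbhsE => -[W [oW Wfx] WO].
have : nbhs (M x) (@pad R n @^-1` W).
  by apply: open_nbhs_nbhs; split; [exact: oW|rewrite /= -fM//; exact: nbhs_singleton nf].
move=> /cM MW; have : nbhs x (f @^-1` O); last by [].
apply: filterS2 (MW : nbhs x (M @^-1` _)) nf => z Wz fz; apply: WO.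
by rewrite /= fM.
Qed.

(** Off the closed support of s the product vanishes near x; on it g is continuous. It extends
    cochains, which are controlled only on overlaps, by the weights that multiply them. *)
Lemma continuous_cutoff (R : realType) (X : topologicalType) (D : set X)
    (s g : X -> R) (x : X) : s @ x --> s x ->
  closure [set z | s z != 0] `<=` D -> (D x -> g @ x --> g x) ->
  (fun z => s z * g z) @ x --> s x * g x.
Proof.
move=> cs sD cg; have [/sD/cg|nsx] := pselect (closure [set z | s z != 0] x).
  exact: cvgM.
have s0 : \forall z \near x, s z = 0.
  have [V Vx sV] : exists2 V, nbhs x V & ~ ([set z | s z != 0] `&` V !=set0).
    apply: contrapT => nV; apply: nsx => V Vx; apply: contrapT => sV.
    by apply: nV; exists V.
  by apply: filterS Vx => z Vz; apply/eqP/negP => sz; apply: sV; exists z; split=> //; apply/negP.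
rewrite (nbhs_singleton s0) mul0r; apply: cvg_near_cst.
by apply: filterS s0 => z ->; rewrite mul0r.
Qed.

Section ClassifyingMaps.
Context {R : realType} {X : topologicalType} {K : countType} (U : K -> set X).
Context (d : nat) (e : \bar R).
Context (phi : K -> X -> R) (pos : K -> nat) (Om : Z1 R U d e).
Hypothesis oU : forall a, open (U a).
Hypothesis pou : partition_of_unity U phi.

Let phi_U a y : phi a y != 0 -> U a y.
Proof. by case: pou => _ _ sU _ _ ya; apply: (sU a); exact: subset_closure. Qed.

(** Turns the sums over all indices into sums over one finite set that serves a whole
    neighbourhood. *)
Lemma near_fset_support (y : X) : exists F : {fset K},
  \forall z \near y, forall a, phi a z != 0 -> a \in F.
Proof.
case: pou => _ _ _ lf _; have [W yW fW] := lf y.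
exists (fset_set [set i | [set z | phi i z != 0] `&` W !=set0]).
by apply: filterS yW => z Wz a az; rewrite in_fset_set//; apply/mem_set; exists z.
Qed.

Lemma frame_fset (F : {fset K}) y i k c :
  (forall a, phi a y != 0 -> a \in F) ->
  frame phi pos Om i y k c = \sum_(j <- F) \sum_(r < d | k == (d * pos j + r)%N)
    Num.sqrt (phi j y) * (Om i j y)^T r c.
Proof.
move=> yF; apply: fsbigTE => a aF; apply: big1 => r _.
have /eqP -> : phi a y == 0 by apply: contraNT aF; exact: yF.
by rewrite sqrtr0 mul0r.
Qed.

Lemma cl_entry_fset (F : {fset K}) y k l :
  (forall a, phi a y != 0 -> a \in F) ->
  cl_entry phi pos Om y k l = \sum_(i <- F) phi i y *
    \sum_(c < d) frame phi pos Om i y k c * frame phi pos Om i y l c.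
Proof.
move=> yF; apply: fsbigTE => a aF.
have /eqP -> : phi a y == 0 by apply: contraNT aF; exact: yF.
by rewrite mul0r.
Qed.

Definition frame_size (F : {fset K}) : nat := \max_(i <- F) (d * pos i + d).

Lemma cl_entry_out (F : {fset K}) y k l :
  (forall a, phi a y != 0 -> a \in F) ->
  (frame_size F <= k)%N || (frame_size F <= l)%N -> cl_entry phi pos Om y k l = 0.
Proof.
move=> yF kl; rewrite (cl_entry_fset _ _ yF); apply: big1 => i _.
have f0 m c : (frame_size F <= m)%N -> frame phi pos Om i y m c = 0.
  move=> mF; rewrite (frame_fset _ _ _ yF); apply: big1_seq => j /andP[_ jF].
  apply: big1 => r /eqP mr; have : (d * pos j + d <= m)%N.
    by apply: leq_trans mF; exact: (@leq_bigmax_seq _ _ _ (fun i => d * pos i + d)%N).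
  by rewrite mr leq_add2l leqNgt ltn_ord.
rewrite big1 ?mulr0// => c _.
by case/orP: kl => /f0 ->; rewrite ?mul0r ?mulr0.
Qed.

Lemma frame_continuous i y k c : U i y ->
  frame phi pos Om i z k c @[z --> y] --> frame phi pos Om i y k c.
Proof.
move=> Uiy; case: (pou) => cphi _ sU _ _.
have [F nF] := near_fset_support y.
rewrite (frame_fset _ _ _ (nbhs_singleton nF)).
apply: (@cvg_trans _ ((fun z => \sum_(j <- F) \sum_(r < d | k == (d * pos j + r)%N)
    Num.sqrt (phi j z) * (Om i j z)^T r c) @ y)).
  by apply: near_eq_cvg; apply: filterS nF => z zF; rewrite (frame_fset _ _ _ zF).
apply: cvg_big => [|j _]; first exact: add_continuous.
apply: cvg_big => [|r _]; first exact: add_continuous.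
apply: (@continuous_cutoff _ _ (U j) (fun z => Num.sqrt (phi j z))).
- apply: (cvg_comp (phi j) Num.sqrt); first exact: cphi.
  exact: sqrt_continuous.
- apply: subset_trans (sU j); apply: closureS => z /=.
  by apply: contraNN => /eqP ->; rewrite sqrtr0.
move=> Ujy; rewrite mxE; under eq_fun do rewrite mxE.
apply: cvg_coord; have /(_ i j) := @Z1_continuous _ _ _ _ _ _ Om.
rewrite continuous_open_subspace; last exact: openI.
by apply; rewrite inE.
Qed.

Lemma cl_entry_continuous k l : continuous (fun y => cl_entry phi pos Om y k l).
Proof.
move=> y; case: (pou) => cphi _ sU _ _; have [F nF] := near_fset_support y.
rewrite /continuous_at (cl_entry_fset _ _ (nbhs_singleton nF)).
apply: (@cvg_trans _ ((fun z => \sum_(i <- F) phi i z *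
    \sum_(c < d) frame phi pos Om i z k c * frame phi pos Om i z l c) @ y)).
  by apply: near_eq_cvg; apply: filterS nF => z zF; rewrite (cl_entry_fset _ _ zF).
apply: cvg_big => [|i _]; first exact: add_continuous.
apply: (@continuous_cutoff _ _ (U i)); [exact: cphi|exact: sU|move=> Uiy].
apply: cvg_big => [|c _]; first exact: add_continuous.
by apply: cvgM; exact: frame_continuous.
Qed.

(** Closed with [Defined], because later steps identify its entries with [cl_entry] by
    conversion. *)
Definition cl_infmx (y : X) : infmx R.
Proof.
exists (cl_entry phi pos Om y).
have [F nF] := near_fset_support y; exists (frame_size F) => k l.
exact: cl_entry_out (nbhs_singleton nF).
Defined.

Lemma cl_infmx_continuous : continuous cl_infmx.
Proof.
apply: continuous_infmx => [k l|y]; first exact: cl_entry_continuous.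
have [F nF] := near_fset_support y; exists (frame_size F).
by apply: filterS nF => z zF k l; exact: cl_entry_out.
Qed.

Hypothesis pos_inj : forall y a b,
  phi a y != 0 -> phi b y != 0 -> pos a = pos b -> a = b.
Hypothesis e_ge0 : (0 <= e)%E.

(** Only the finite set F of indices active at y contributes, and over F the matrix is the
    combination treated by [Gr_thick_block_comb]. *)
Lemma cl_infmx_Gr_thick y : Gr_thick d ((Num.sqrt 2)%:E * e)%E (cl_infmx y).
Proof.
case: (pou) => _ phi0 _ lf phi1.
have fin : finite_set [set a | phi a y != 0].
  have [F nF] := near_fset_support y; apply: (finite_subfset F) => a.
  exact: (nbhs_singleton nF).
pose F := fset_set [set a | phi a y != 0].
have FE a : (a \in F) = (phi a y != 0).
  by rewrite /F in_fset_set//; apply/idP/idP; rewrite inE.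
have yF a : phi a y != 0 -> a \in F by rewrite FE.
have Uy (a : F) : U (val a) y by apply: phi_U; rewrite -FE; exact: valP.
pose n := frame_size F.
pose E (a : F) : 'M[R]_(n, d) := \matrix_(k, r) ((k : nat) == d * pos (val a) + r)%N%:R.
pose O (a b : F) := Om (val a) (val b) y.
have Oorth (a b : F) : (O a b)^T *m O a b = 1%:M by apply: Z1_orthogonal; split.
have OT (a b : F) : (O a b)^T = O b a.
  rewrite [RHS](@Z1_inv _ _ _ _ _ _ Om); last by split.
  have u := orthogonal_unit (Oorth a b).
  by rewrite -[LHS]mulmx1 -(mulmxV u) mulmxA Oorth mul1mx.
have posF (a : F) (r : 'I_d) : (d * pos (val a) + r < n)%N.
  have : (d * pos (val a) + d <= n)%N.
    by apply: (@leq_bigmax_seq _ _ _ (fun i => d * pos i + d)%N) => //; exact: valP.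
  by apply: leq_trans; rewrite ltn_add2l.
have w_gt0 (a : F) : 0 < phi (val a) y.
  by rewrite lt_neqAle eq_sym phi0 andbT -FE; exact: valP.
have w_sum : \sum_(a : F) phi (val a) y = 1.
  rewrite -(phi1 y) (fsbigTE F) ?big_seq_fsetE// => a aF; apply/eqP.
  by apply: contraNT aF; exact: yF.
have Eort (a b : F) : (E a)^T *m E b = (a == b)%:R%:M.
  apply/matrixP => r s; rewrite !mxE (bigD1 (Ordinal (posF a r)))//= big1.
    rewrite !mxE/= eqxx mul1r addr0 -mulrnA; congr (_%:R).
    (* The row index r of type ['I_d] witnesses that d is positive. *)
    have d0 : (0 < d)%N by apply: leq_ltn_trans (ltn_ord r).
    have [<-|ab] := eqVneq a b; first by rewrite eqn_add2l mul1n.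
    (* Dividing the row number by d recovers the block position, so distinct active indices share no
       row. *)
    apply/eqP; rewrite mul0n eqb0; apply: contraNN ab => /eqP /(congr1 (divn^~ d)).
    rewrite !(mulnC d) !divnMDl// !divn_small ?ltn_ord// !addn0 => pab.
    by apply/eqP/val_inj; apply: (pos_inj (y := y)) pab; rewrite -FE; exact: valP.
  move=> k ka; rewrite !mxE; case: eqP => [ka'|]; last by rewrite mul0r.
  by move: ka; rewrite -(inj_eq val_inj)/= ka' eqxx.
have Oapp (a b c : F) : approx_eq e (O a b *m O b c) (O a c).
  by apply: Z1_approx; split; [split|].
have -> : cl_infmx y = pad (\sum_a phi (val a) y *:
    (block_comb (fun a => phi (val a) y) E (O^~ a) *m
     (block_comb (fun a => phi (val a) y) E (O^~ a))^T)).
  have frameE (a : F) (k : 'I_n) c : frame phi pos Om (val a) y k c =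
      block_comb (fun a => phi (val a) y) E (O^~ a) k c.
    rewrite (frame_fset _ _ _ yF) big_seq_fsetE summxE; apply: eq_bigr => b _.
    rewrite !mxE mulr_sumr big_mkcond/=; apply: eq_bigr => r _; rewrite !mxE.
    rewrite -(OT a b) mxE; case: eqP => _; last by rewrite mul0r mulr0.
    by rewrite mul1r.
  apply: infmxP => k l; have [kl|] := boolP ((n <= k)%N || (n <= l)%N).
    by rewrite pad_out// [LHS](cl_entry_out yF).
  rewrite negb_or -!ltnNge => /andP[kn ln].
  rewrite -[k]/(val (Ordinal kn)) -[l]/(val (Ordinal ln)) padE.
  rewrite [LHS](cl_entry_fset _ _ yF) big_seq_fsetE summxE; apply: eq_bigr => a _.
  rewrite !mxE; congr (_ * _); apply: eq_bigr => c _.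
  by rewrite -!frameE mxE -frameE.
exact: Gr_thick_block_comb.
Qed.

Definition cl_map : map_into X (infmx R) (Gr_thick d ((Num.sqrt 2)%:E * e)%E) :=
  MapInto cl_infmx_continuous cl_infmx_Gr_thick.

End ClassifyingMaps.

(** * Partitions of unity on paracompact spaces *)

Section Paracompact.
Context {B : topologicalType}.
Hypothesis pB : paracompact B.

Definition locally_finite (D : set (set B)) : Prop :=
  forall y : B, exists2 W, nbhs y W & finite_set [set S | D S /\ S `&` W !=set0].

(** A point y outside every closure has a neighbourhood meeting finitely many members; removing the
    closed union of their closures leaves a neighbourhood of y that misses the whole union. *)
Lemma closure_bigcup_locally_finite (D : set (set B)) : locally_finite D ->
  closure (\bigcup_(S in D) S) `<=` \bigcup_(S in D) closure S.
Proof.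
move=> lfD y cy; apply: contrapT => ny.
have [W yW fW] := lfD y; set F := [set S | _] in fW.
have cF : closed (\bigcup_(S in F) closure S).
  by apply: closed_bigcup => // S _; exact: closed_closure.
have : nbhs y (W `&` ~` \bigcup_(S in F) closure S).
  apply: filterI yW _; apply: open_nbhs_nbhs; split; first exact: closed_openC.
  by move=> [S [DS _] Sy]; apply: ny; exists S.
move=> /cy [z [[S DS Sz] [Wz nz]]]; apply: nz; exists S; last exact: subset_closure.
by split=> //; exists z.
Qed.

(** Cover the space by the given neighbourhoods and the complement of A, refine, and take the union
    of the members that meet A. Each of them lies in a set whose closure misses C, and local
    finiteness carries this over to the closure of the union. With C a point this yields regularity;
    with C closed, regularity then yields normality. *)
Lemma paracompact_separation (A C : set B) : closed A ->
  (forall a, A a -> exists N, [/\ open N, N a & C `<=` ~` closure N]) ->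
  exists V, [/\ open V, A `<=` V & C `<=` ~` closure V].
Proof.
move=> cA AC.
pose G := [set N | open N /\ (C `<=` ~` closure N \/ N = ~` A)].
have [||D [oD cD DG lD]] := pB.2 G; first by move=> N [].
  apply/seteqP; split=> // y _; have [/AC[N [oN Ny CN]]|nAy] := pselect (A y).
    by exists N => //; split=> //; left.
  by exists (~` A) => //; split; [exact: closed_openC|right].
pose DA := D `&` [set S | S `&` A !=set0].
exists (\bigcup_(S in DA) S); split.
- by apply: bigcup_open => S [/oD].
- move=> a Aa; have : [set: B] a by [].
  by rewrite -cD => -[S DS Sa]; exists S => //; split=> //; exists a.
move=> c Cc /closure_bigcup_locally_finite -[].
  move=> y; have [W yW fW] := lD y; exists W => //.
  by apply: sub_finite_set fW => S [[DS _] SW]; split.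
move=> S [DS [a [Sa Aa]]] Sc; have [N [_ [CN|NA]] SN] := DG _ DS.
  by apply: (CN _ Cc); exact: closureS SN _ Sc.
by have := SN _ Sa; rewrite NA; exact.
Qed.

Lemma closure_setC_closure (V : set B) : open V -> closure (~` closure V) `<=` ~` V.
Proof.
move=> oV; rewrite [X in _ `<=` X](_ : _ = closure (~` V)); last first.
  by apply/closure_id; exact: open_closedC.
by apply: closureS; apply: subsetC; exact: subset_closure.
Qed.

Lemma paracompact_regular (A : set B) (x : B) : closed A -> ~ A x ->
  exists N, [/\ open N, N x & closure N `<=` ~` A].
Proof.
move=> cA nAx; have [a Aa|V [oV AV xV]] := paracompact_separation (C := [set x]) cA.
  have ax : a != x by apply/eqP => e; rewrite -e in nAx.
  have := pB.1; rewrite open_hausdorff => /(_ a x ax)[[P Q]/= [/set_mem Pa /set_mem Qx]].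
  move=> [oP oQ /eqP PQ]; exists P; split=> // _ ->.
  by move=> /(_ Q (open_nbhs_nbhs (conj oQ Qx))); rewrite PQ => -[].
exists (~` closure V); split; first by apply: closed_openC; exact: closed_closure.
  exact: xV.
by move=> z /(closure_setC_closure oV) + /AV.
Qed.

Lemma paracompact_normal : normal_space B.
Proof.
move=> A cA W /set_nbhsP[C [oC AC CW]].
have [a Aa|V [oV AV CV]] := paracompact_separation (C := ~` C) cA.
  have [||N [oN Na NC]] := @paracompact_regular (~` C) a; first exact: open_closedC.
    by move/(_ (AC _ Aa)).
  by exists N; split=> // c Cc /NC.
exists V; first by apply/set_nbhsP; exists V; split.
by move=> z Vz; apply: CW; apply: contrapT => /CV; exact.
Qed.

(** Regularity provides a cover by open sets whose closures lie in some U_i. In a locally finite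
    refinement each member is assigned one such index, and W_i is the union of the members assigned
    to i. *)
Lemma paracompact_shrinking (I : Type) (U : I -> set B) : open_cover U ->
  exists W : I -> set B, [/\ open_cover W, forall i, closure (W i) `<=` U i
    & forall y : B, exists2 N, nbhs y N & finite_set [set i | W i `&` N !=set0]].
Proof.
move=> [oU cU]; pose G := [set N | open N /\ exists i, closure N `<=` U i].
have [||D [oD cD DG lD]] := pB.2 G; first by move=> N [].
  apply/seteqP; split=> // y _; have [i Uiy] := cU y.
  have [||N [oN Ny NU]] := @paracompact_regular (~` U i) y; first exact: open_closedC.
    exact.
  by exists N => //; split=> //; exists i => z /NU /contrapT.
(* The value [None] serves sets outside D, for which a suitable index may not exist. *)
have /choice[f Df] (S : set B) : exists o : option I,
    D S -> exists2 i, o = Some i & closure S `<=` U i.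
  have [DS|nDS] := pselect (D S); last by exists None.
  have [N [_ [i NU]] SN] := DG _ DS; exists (Some i) => _; exists i => //.
  by apply: subset_trans NU; exact: closureS.
exists (fun i => \bigcup_(S in D `&` [set S | f S = Some i]) S); split.
- split=> [i|y]; first by apply: bigcup_open => S [/oD].
  have : [set: B] y by [].
  by rewrite -cD => -[S DS Sy]; have [i fi _] := Df _ DS; exists i, S.
- move=> i y /closure_bigcup_locally_finite -[].
    move=> z; have [N zN fN] := lD z; exists N => //.
    by apply: sub_finite_set fN => S [[DS _] SW]; split.
  by move=> S [DS fS]; have [j] := Df _ DS; rewrite fS => -[->]; exact.
move=> y; have [N yN fN] := lD y; exists N => //.
(* The indices i whose W_i meets N are among those assigned to the finitely many members of D
   meeting N. *)
have /finite_preimage : finite_set (f @` [set S | D S /\ S `&` N !=set0]).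
  exact: finite_image.
move=> /(_ _ Some); move=> h; apply: sub_finite_set (h _) => [i|? ? _ _ []//].
by move=> [z [[S [DS fS] Sz] Nz]]; exists S => //; split=> //; exists z.
Qed.

(** After shrinking twice, Urysohn functions equal to 1 on the closure of W'_i and 0 off W_i are
    divided by their sum. The sum is positive because the W'_i cover, and it is locally finite
    because the W_i are. *)
Lemma paracompact_partition_of_unity (R : realType) (I : countType) (U : I -> set B) :
  open_cover U -> exists phi : I -> B -> R, partition_of_unity U phi.
Proof.
move=> cU; have [W [cW WU lW]] := paracompact_shrinking cU.
have [W' [cW' W'W _]] := paracompact_shrinking cW.
have sep i : uniform_separator (~` W i) (closure (W' i)).
  apply: (normal_uniform_separator paracompact_normal).
  - by apply: open_closedC; exact: cW.1.
  - exact: closed_closure.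
  - by apply/seteqP; split=> // y [nW /W'W].
pose f i : B -> R := Urysohn (~` W i) (closure (W' i)).
have f_ge0 i y : 0 <= f i y.
  have /(_ (f i y)) := @Urysohn_range B R (~` W i) (closure (W' i)).
  by rewrite /= in_itv/= => h; have /andP[] : 0 <= f i y <= 1 by apply: h; exists y.
have f_out i y : f i y != 0 -> W i y.
  move=> fy; apply: contrapT => nW; move/eqP: fy; apply.
  by apply: (@Urysohn_sub0 B R _ _ (sep i)); exists y.
have near_support (y : B) : exists F : {fset I},
    \forall z \near y, forall i, f i z != 0 -> i \in F.
  have [N yN fN] := lW y; exists (fset_set [set i | W i `&` N !=set0]).
  apply: filterS yN => z Nz i /f_out Wz.
  by rewrite in_fset_set//; apply/mem_set; exists z.
pose S y := \sum_(i \in [set: I]) f i y.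
have SE (F : {fset I}) y : (forall i, f i y != 0 -> i \in F) ->
    S y = \sum_(i <- F) f i y.
  by move=> yF; apply: fsbigTE => i iF; apply/eqP; apply: contraNT iF; exact: yF.
have S_gt0 y : 0 < S y.
  have [F /nbhs_singleton yF] := near_support y; have [i W'i] := cW'.2 y.
  have fi : f i y = 1.
    by apply: (@Urysohn_sub1 B R _ _ (sep i)); exists y => //; exact: subset_closure.
  have iF : i \in F by apply: yF; rewrite fi oner_eq0.
  rewrite (SE _ _ yF) big_seq_fsetE (bigD1 [` iF]%fset)//= fi.
  by apply: lt_le_trans ltr01 _; rewrite lerDl sumr_ge0.
have S_continuous : continuous S.
  move=> y; have [F nF] := near_support y.
  rewrite /continuous_at (SE _ _ (nbhs_singleton nF)).
  apply: (@cvg_trans _ ((fun z => \sum_(i <- F) f i z) @ y)).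
    by apply: near_eq_cvg; apply: filterS nF => z zF; rewrite (SE _ _ zF).
  apply: cvg_big => [|i _]; first exact: add_continuous.
  exact: Urysohn_continuous.
have suppE i y : f i y / S y != 0 -> f i y != 0.
  by apply: contraNN => /eqP ->; rewrite mul0r.
exists (fun i y => f i y / S y); split.
- move=> i y; apply: cvgM; first exact: Urysohn_continuous.
  by apply: cvgV; [rewrite gt_eqF|exact: S_continuous].
- by move=> i y; rewrite divr_ge0// ltW.
- move=> i; apply: subset_trans (WU i); apply: closureS => y /suppE.
  exact: f_out.
- move=> y; have [N yN fN] := lW y; exists N => //.
  by apply: sub_finite_set fN => i [z [/suppE/f_out Wz Nz]]; exists z.
move=> y; have [F /nbhs_singleton yF] := near_support y.
rewrite (fsbigTE F) => [|i iF]; last first.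
  by apply/eqP; apply: contraNT iF => /suppE; exact: yF.
by rewrite -mulr_suml -SE// divff// gt_eqF.
Qed.

End Paracompact.

(** * Homotopies from moving weights *)

Section FiniteSupportSums.
Context {R : realType}.

Lemma fsum_reindex_inj (I K : choiceType) (h : I -> K) (F : K -> R) :
  injective h -> (forall a, ~ range h a -> F a = 0) ->
  \sum_(a \in [set: K]) F a = \sum_(i \in [set: I]) F (h i).
Proof.
move=> hI F0; rewrite -(fsbig_widen (range h)) ?fsbig_image//.
  by move=> i j _ _; exact: hI.
by move=> a [_ /F0].
Qed.

(** The finite sets A and C exclude infinite supports, on which such sums take the default value
    0. *)
Lemma fsum_sum (I J : choiceType) (F : I + J -> R) (A : {fset I}) (C : {fset J}) :
  (forall i, i \notin A -> F (inl i) = 0) -> (forall j, j \notin C -> F (inr j) = 0) ->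
  \sum_(a \in [set: I + J]) F a =
  \sum_(i \in [set: I]) F (inl i) + \sum_(j \in [set: J]) F (inr j).
Proof.
move=> FA FC; rewrite [X in X + _](fsbigTE A)// [X in _ + X](fsbigTE C)//.
rewrite (fsbigE ([seq inl i | i <- A] ++ [seq inr j | j <- C]))//.
- by under eq_bigl do rewrite in_setT; rewrite big_cat !big_map.
- rewrite cat_uniq !map_inj_uniq ?fset_uniq//=; [|by move=> ? ? []..].
  by rewrite andbT; apply/hasPn => _ /mapP[j _ ->]; apply/mapP => -[].
move=> [i|j] _; rewrite mem_cat negb_or => /andP[iA jC].
  by apply: FA; apply: contraNN iA => iA; apply/mapP; exists i.
by apply: FC; apply: contraNN jC => jC; apply/mapP; exists j.
Qed.

End FiniteSupportSums.

(** Identifies the ends of a homotopy with given classifying maps: indices outside the range of h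
    have weight 0, and the cochains are compared only where both weights are nonzero. *)
Lemma cl_entry_reindex (R : realType) (X Y : topologicalType) (K I : countType)
    (W : K -> set X) (U : I -> set Y) (d : nat) (e e' : \bar R)
    (Om : Z1 R W d e) (La : Z1 R U d e') (psi : K -> X -> R) (phi : I -> Y -> R)
    (pos : K -> nat) (iota : I -> nat) (h : I -> K) (x : X) (y : Y) k l :
  injective h -> (forall i, psi (h i) x = phi i y) ->
  (forall a, ~ range h a -> psi a x = 0) ->
  (forall i, pos (h i) = iota i) ->
  (forall i j, phi i y != 0 -> phi j y != 0 -> Om (h i) (h j) x = La i j y) ->
  cl_entry psi pos Om x k l = cl_entry phi iota La y k l.
Proof.
move=> hI psih psi0 posh Omh.
have frameE i m c : phi i y != 0 ->
    frame psi pos Om (h i) x m c = frame phi iota La i y m c.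
  move=> iy.
  rewrite /frame (fsum_reindex_inj hI) => [|a /psi0 a0]; last first.
    by apply: big1 => r _; rewrite a0 sqrtr0 mul0r.
  apply: eq_fsbigr => j _; rewrite posh psih; apply: eq_bigr => r _.
  by have [->|jy] := eqVneq (phi j y) 0; rewrite ?sqrtr0 ?mul0r// Omh.
rewrite /cl_entry (fsum_reindex_inj hI) => [|a /psi0 ->]; last by rewrite mul0r.
apply: eq_fsbigr => i _; rewrite psih.
have [->|iy] := eqVneq (phi i y) 0; first by rewrite !mul0r.
by congr (_ * _); apply: eq_bigr => c _; rewrite !frameE.
Qed.

Section Pullback.
Context {R : realType} {X B : topologicalType} {K : Type} {U : K -> set B}.
Context {d : nat} {e : \bar R} (g : X -> B) (cg : continuous g) (Om : Z1 R U d e).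

Lemma Z1_pullback_continuous i j :
  {within g @^-1` U j `&` g @^-1` U i, continuous (fun x => Om i j (g x))}.
Proof.
apply: (@continuous_within_comp _ _ _ _ (U j `&` U i) g (Om i j)) => //.
exact: Z1_continuous.
Qed.

(** Used with the projection from B x R to B, so that a homotopy is itself a classifying map over
    the product. *)
Definition Z1_pullback : Z1 R (fun a => g @^-1` U a) d e :=
  @Cocycle R X K (fun a => g @^-1` U a) d e (fun i j x => Om i j (g x))
    (fun i j x h => @Z1_orthogonal _ _ _ _ _ _ Om i j (g x) h)
    Z1_pullback_continuous
    (fun i j x h => @Z1_inv _ _ _ _ _ _ Om i j (g x) h)
    (fun i j k x h => @Z1_approx _ _ _ _ _ _ Om i j k (g x) h).

End Pullback.

Definition sum_cover (B : topologicalType) (I J : Type) (U : I -> set B)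
    (V : J -> set B) (a : I + J) : set B :=
  match a with inl i => U i | inr j => V j end.

Definition sum_fun (I J T : Type) (f : I -> T) (g : J -> T) (a : I + J) : T :=
  match a with inl i => f i | inr j => g j end.

Section SumCoverHomotopy.
Context {R : realType} {B : topologicalType} {I J : countType}.
Context {U : I -> set B} {V : J -> set B}.

Lemma refinement_inl : refinement (sum_cover U V) U inl.
Proof. by move=> ? ?. Qed.

Lemma refinement_inr : refinement (sum_cover U V) V inr.
Proof. by move=> ? ?. Qed.

Context (d : nat) (e : \bar R) (D : Z1 R (sum_cover U V) d e).
Context (phi : I -> B -> R) (psi : J -> B -> R) (iota : I -> nat) (kappa : J -> nat).
Context (lam : I -> R -> R) (mu : J -> R -> R).
Hypothesis oU : forall i, open (U i).
Hypothesis oV : forall j, open (V j).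
Hypothesis pphi : partition_of_unity U phi.
Hypothesis ppsi : partition_of_unity V psi.
Hypothesis e_ge0 : (0 <= e)%E.
Hypothesis lam_continuous : forall i, continuous (lam i).
Hypothesis mu_continuous : forall j, continuous (mu j).
Hypothesis lam_ge0 : forall i t, 0 <= lam i t.
Hypothesis mu_ge0 : forall j t, 0 <= mu j t.

Let weight (a : I + J) (p : B * R) : R :=
  match a with inl i => lam i p.2 * phi i p.1 | inr j => mu j p.2 * psi j p.1 end.

Hypothesis weight_sum : forall x t,
  \sum_(i \in [set: I]) lam i t * phi i x + \sum_(j \in [set: J]) mu j t * psi j x = 1.
Hypothesis pos_inj : forall p a b, weight a p != 0 -> weight b p != 0 ->
  sum_fun iota kappa a = sum_fun iota kappa b -> a = b.

Lemma weight_partition_of_unity :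
  partition_of_unity (fun a => @fst B R @^-1` sum_cover U V a) weight.
Proof.
have [cphi phi0 sU lfphi _] := pphi; have [cpsi psi0 sV lfpsi _] := ppsi.
have supp a p : weight a p != 0 -> sum_fun phi psi a p.1 != 0.
  by case: a => [i|j]; apply: contraNN => /eqP/= ->; rewrite mulr0.
have lf (x : B) : exists2 W, nbhs x W & exists A : {fset I}, exists C : {fset J},
    forall z, W z -> (forall i, phi i z != 0 -> i \in A) /\
                     (forall j, psi j z != 0 -> j \in C).
  have [A nA] := near_fset_support pphi x; have [C nC] := near_fset_support ppsi x.
  exists [set z | (forall i, phi i z != 0 -> i \in A) /\
                     (forall j, psi j z != 0 -> j \in C)]; last by exists A, C.
  exact: filterI.
split.
- move=> [i|j] p; apply: cvgM.
  + by apply: (cvg_comp (@snd B R) (lam i)); [exact: cvg_snd|exact: lam_continuous].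
  + by apply: (cvg_comp (@fst B R) (phi i)); [exact: cvg_fst|exact: cphi].
  + by apply: (cvg_comp (@snd B R) (mu j)); [exact: cvg_snd|exact: mu_continuous].
  + by apply: (cvg_comp (@fst B R) (psi j)); [exact: cvg_fst|exact: cpsi].
- by move=> [i|j] p; rewrite mulr_ge0.
- move=> a p cp; have sa : closure [set x | sum_fun phi psi a x != 0] `<=` sum_cover U V a.
    by case: a {cp supp} => [i|j]; [exact: sU|exact: sV].
  apply: sa => W /(@continuous_fst B R p)/cp.
  by move=> [q [/supp ? ?]]; exists q.1.
- move=> [x t]; have [W xW [A [C WAC]]] := lf x.
  exists (@fst B R @^-1` W); first exact: (@continuous_fst B R (x, t)).
  have fA : finite_set ((@inl I J) @` [set` A] `|` (@inr I J) @` [set` C]).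
    by rewrite finite_setU; split; apply: finite_image; exact: finite_fset.
  apply: sub_finite_set fA => a [q [/supp + /WAC[]]].
  by case: a => [i|j] /= qa qA qC; [left|right]; [exists i|exists j] => //; [exact: qA|exact: qC].
move=> [x t]; have [W /nbhs_singleton xW [A [C /(_ _ xW)[xA xC]]]] := lf x.
rewrite (fsum_sum (A := A) (C := C)); first exact: weight_sum.
  move=> i iA /=; have /eqP -> : phi i x == 0 by apply: contraNT iA; exact: xA.
  by rewrite mulr0.
move=> j jC /=; have /eqP -> : psi j x == 0 by apply: contraNT jC; exact: xC.
by rewrite mulr0.
Qed.

Hypothesis lam0 : forall i, lam i 0 = 1.
Hypothesis lam1 : forall i, lam i 1 = 0.
Hypothesis mu0 : forall j, mu j 0 = 0.
Hypothesis mu1 : forall j, mu j 1 = 1.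

(** The homotopy is the classifying map over B x R of the pulled back cocycle with the moving
    weights. At time 0 all weight sits on the left half, at time 1 on the right. *)
Lemma homotopic_weights (f0 f1 : B -> infmx R) :
  (forall x k l, f0 x k l = cl_entry phi iota (Z1_refine refinement_inl D) x k l) ->
  (forall x k l, f1 x k l = cl_entry psi kappa (Z1_refine refinement_inr D) x k l) ->
  homotopic R (Gr_thick d ((Num.sqrt 2)%:E * e)%E) f0 f1.
Proof.
move=> f0E f1E.
have oW a : open (@fst B R @^-1` sum_cover U V a).
  have cfst : continuous (@fst B R) by exact: continuous_fst.
  by move/continuousP: cfst; apply; case: a.
pose H := cl_map (Z1_pullback (@continuous_fst B R) D) oW weight_partition_of_unity
  pos_inj e_ge0.
exists H; split.
- by apply: continuous_subspaceT; exact: map_continuous.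
- by move=> x t _; exact: map_in.
- move=> x; apply: infmxP => k l; rewrite f0E; apply: (cl_entry_reindex (h := inl)) => //.
  + by move=> ? ? [].
  + by move=> i /=; rewrite lam0 mul1r.
  + by move=> [i []|j _ /=]; [exists i|rewrite mu0 mul0r].
- move=> x; apply: infmxP => k l; rewrite f1E; apply: (cl_entry_reindex (h := inr)) => //.
  + by move=> ? ? [].
  + by move=> i /=; rewrite mu1 mul1r.
  + by move=> [i _ /=|j []]; [rewrite lam1 mul0r|exists j].
Qed.

End SumCoverHomotopy.

(** * Time functions for the moving weights *)

Section Clamp.
Context {R : realType}.

(** Homotopies are built over all of B x R, so the weights must remain in [0, 1] for every real
    time. *)
Definition clamp (x : R) : R := Num.max 0 (Num.min 1 x).

Lemma clamp_continuous : continuous clamp.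
Proof.
move=> x; have min1 : {for x, continuous ((fun=> 1 : R^o) \min (id : R -> R^o))}.
  by apply: continuous_min; [exact: cvg_cst|exact: cvg_id].
exact: (continuous_max (cvg_cst (0 : R^o)) min1).
Qed.

Lemma clamp_ge0 x : 0 <= clamp x.
Proof. by rewrite le_max lexx. Qed.

Lemma clamp_le1 x : clamp x <= 1.
Proof. by rewrite ge_max ler01 ge_min lexx. Qed.

Lemma clamp_eq0 x : x <= 0 -> clamp x = 0.
Proof. by move=> x0; apply/max_idPl; rewrite ge_min x0 orbT. Qed.

Lemma clamp_eq1 x : 1 <= x -> clamp x = 1.
Proof. by move=> x1; rewrite /clamp (min_idPl x1); apply/max_idPr. Qed.

(* Runs from 0 to 1 while t runs over [1/(n+1), 1/n]. *)
Definition step (n : nat) (t : R) : R := clamp (n%:R * n.+1%:R * t - n%:R).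

Lemma step_continuous n : continuous (step n).
Proof.
move=> t; apply: (cvg_comp (fun t => n%:R * n.+1%:R * t - n%:R) clamp).
  by apply: cvgB; [apply: cvgM; [exact: cvg_cst|exact: cvg_id]|exact: cvg_cst].
exact: clamp_continuous.
Qed.

Lemma step0 n : step n 0 = 0.
Proof. by rewrite /step clamp_eq0// mulr0 sub0r oppr_le0. Qed.

Lemma step1 n : (0 < n)%N -> step n 1 = 1.
Proof.
move=> n0; apply: clamp_eq1; rewrite mulr1 -natr1 mulrDr mulr1 addrK -natrM ler1n.
by rewrite muln_gt0 n0.
Qed.

(** Once n has started to move, t > 1/(n+1) >= 1/m, and by time 1/m the index m has finished. *)
Lemma step_lt m n t : (0 < n < m)%N -> step n t != 0 -> step m t = 1.
Proof.
move=> /andP[n0 nm] nt; apply: clamp_eq1.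
have {}nt : 0 < n%:R * n.+1%:R * t - n%:R.
  by rewrite ltNge; apply: contraNN nt => /clamp_eq0/eqP.
have n0' : 0 < n%:R :> R by rewrite ltr0n.
have nt1 : 1 < n.+1%:R * t by rewrite -(ltr_pM2l n0') mulr1 mulrA -subr_gt0.
have t0 : 0 < t by rewrite -(pmulr_rgt0 _ (ltr0Sn R n)); apply: lt_trans nt1.
have mt1 : 1 < m%:R * t by apply: lt_le_trans nt1 _; rewrite ler_pM2r// ler_nat.
(* The claim amounts to (m + 1)(m t - 1) >= 0. *)
by rewrite -natr1; nra.
Qed.

End Clamp.

Section CoverHomotopies.
Context {R : realType} {B : topologicalType} (d : nat) (e : \bar R).
Hypothesis e_ge0 : (0 <= e)%E.

Let homotopicA := @homotopic R B _ (Gr_thick d ((Num.sqrt 2)%:E * e)%E).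

Lemma partition_of_unity_split (I : countType) (U : I -> set B) (phi : I -> B -> R)
    (c : I -> R) (x : B) : partition_of_unity U phi ->
  \sum_(i \in [set: I]) (1 - c i) * phi i x +
  \sum_(i \in [set: I]) c i * phi i x = 1.
Proof.
move=> pphi; have [A /nbhs_singleton xA] := near_fset_support pphi x.
have [_ _ _ _ phi1] := pphi; rewrite -[RHS](phi1 x).
have phiA i : i \notin A -> phi i x = 0.
  by move=> iA; apply/eqP; apply: contraNT iA; exact: xA.
rewrite !(fsbigTE A) => [|i /phiA|i /phiA ->|i /phiA ->]; rewrite ?mulr0//.
by rewrite -big_split; apply: eq_bigr => i _ /=; rewrite -mulrDl subrK mul1r.
Qed.

Lemma homotopic_disjoint (I J : countType) (U : I -> set B) (V : J -> set B)
    (D : Z1 R (sum_cover U V) d e) phi psi (iota : I -> nat) (kappa : J -> nat)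
    (f0 f1 : B -> infmx R) :
  (forall i, open (U i)) -> (forall j, open (V j)) ->
  partition_of_unity U phi -> partition_of_unity V psi ->
  injective iota -> injective kappa -> (forall i j, iota i <> kappa j) ->
  (forall x k l, f0 x k l =
     cl_entry phi iota (Z1_refine (@refinement_inl _ _ _ U V) D) x k l) ->
  (forall x k l, f1 x k l =
     cl_entry psi kappa (Z1_refine (@refinement_inr _ _ _ U V) D) x k l) ->
  homotopicA f0 f1.
Proof.
move=> oU oV pphi ppsi iI kI ik f0E f1E.
apply: (homotopic_weights oU oV pphi ppsi e_ge0
  (lam := fun _ t => 1 - clamp t) (mu := fun _ => clamp) _ _ _ _ _ _ _ _ _ _ f0E f1E).
- by move=> _ t; apply: cvgB; [exact: cvg_cst|exact: clamp_continuous].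
- by move=> _; exact: clamp_continuous.
- by move=> _ t; rewrite subr_ge0 clamp_le1.
- by move=> _ t; exact: clamp_ge0.
- move=> x t; rewrite -!mulr_fsumr; case: pphi ppsi => _ _ _ _ -> [_ _ _ _ ->].
  by rewrite !mulr1 subrK.
- by move=> p [i|j] [i'|j'] _ _ /= => [/iI ->|/ik|/esym/ik|/kI ->].
- by move=> _; rewrite clamp_eq0// subr0.
- by move=> _; rewrite clamp_eq1// subrr.
- by move=> _; rewrite clamp_eq0.
- by move=> _; rewrite clamp_eq1.
Qed.

(* The index n moves to s n during [1/(n+1), 1/n], when the indices above n,
   s n among them, have already left; near t = 0 nothing visible moves. *)
Lemma homotopic_shift (I : countType) (U : I -> set B) (Om : Z1 R U d e) phi
    (iota : I -> nat) (s : nat -> nat) (f0 f1 : B -> infmx R) :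
  (forall i, open (U i)) -> partition_of_unity U phi -> index_injection iota ->
  injective s -> (forall n, (0 < n -> n < s n)%N) ->
  (forall x k l, f0 x k l = cl_entry phi iota Om x k l) ->
  (forall x k l, f1 x k l = cl_entry phi (s \o iota) Om x k l) ->
  homotopicA f0 f1.
Proof.
move=> oU pphi [iI i0] sI sgt f0E f1E.
(* Both halves carry the same cocycle; they differ only in the positions of their blocks. *)
have fold : refinement U (sum_cover U U) (sum_fun id id) by move=> [] ? ?.
apply: (homotopic_weights oU oU pphi pphi e_ge0 (D := Z1_refine fold Om)
  (lam := fun i t => 1 - step (iota i) t) (mu := fun i => step (iota i))
  _ _ _ _ _ _ _ _ _ _ f0E f1E).
- by move=> i t; apply: cvgB; [exact: cvg_cst|exact: step_continuous].
- by move=> i; exact: step_continuous.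
- by move=> i t; rewrite subr_ge0 clamp_le1.
- by move=> i t; exact: clamp_ge0.
- by move=> x t; exact: (partition_of_unity_split (fun i => step (iota i) t) x pphi).
- have cross i j p : (1 - step (iota i) p.2) * phi i p.1 != 0 ->
      step (iota j) p.2 * phi j p.1 != 0 -> iota i = s (iota j) -> False.
    rewrite !mulf_eq0 !negb_or => /andP[+ _] /andP[+ _] ij.
    move=> + /(@step_lt _ (iota i)) st; rewrite st ?subrr ?eqxx//.
    by rewrite i0 ij sgt.
  move=> p [i|j] [i'|j'] /= pa pb; first by move/iI ->.
  + by move/(cross _ _ _ pa pb).
  + by move/esym/(cross _ _ _ pb pa).
  + by move/sI/iI ->.
- by move=> i; rewrite step0 subr0.
- by move=> i; rewrite step1// subrr.
- by move=> i; rewrite step0.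
- by move=> i; rewrite step1.
Qed.

(** Shifting one half to even and the other to odd positions makes the positions disjoint, so that
    the weights can move between the halves. Positions start at 1, which gives n < 2n as the shift
    requires. *)
Lemma homotopic_sum_cover (I J : countType) (U : I -> set B) (V : J -> set B)
    (D : Z1 R (sum_cover U V) d e) phi psi (iota : I -> nat) (kappa : J -> nat)
    (f0 f1 : B -> infmx R) :
  (forall i, open (U i)) -> (forall j, open (V j)) ->
  partition_of_unity U phi -> partition_of_unity V psi ->
  index_injection iota -> index_injection kappa ->
  (forall x k l, f0 x k l =
     cl_entry phi iota (Z1_refine (@refinement_inl _ _ _ U V) D) x k l) ->
  (forall x k l, f1 x k l =
     cl_entry psi kappa (Z1_refine (@refinement_inr _ _ _ U V) D) x k l) ->
  homotopicA f0 f1.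
Proof.
move=> oU oV pphi ppsi iI kI f0E f1E.
pose s0 n := n.*2; pose s1 n := n.*2.+1.
have s0I : injective s0 by exact: double_inj.
have s1I : injective s1 by move=> m n [] /double_inj.
have i0I : injective (s0 \o iota) by apply: inj_comp => //; case: iI.
have k1I : injective (s1 \o kappa) by apply: inj_comp => //; case: kI.
have inj_pos (K : countType) (pos : K -> nat) (chi : K -> B -> R) : injective pos ->
  forall y a b, chi a y != 0 -> chi b y != 0 -> pos a = pos b -> a = b.
  by move=> pI y a b _ _ /pI.
pose g0 := cl_map (Z1_refine (@refinement_inl _ _ _ U V) D) oU pphi
  (inj_pos _ _ _ i0I) e_ge0.
pose g1 := cl_map (Z1_refine (@refinement_inr _ _ _ U V) D) oV ppsi
  (inj_pos _ _ _ k1I) e_ge0.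
have fg0 : homotopicA f0 g0.
  apply: (homotopic_shift (s := s0) oU pphi iI s0I _ f0E) => // n n0.
  by rewrite /s0 -addnn -[X in (X < _)%N]addn0 ltn_add2l.
have fg1 : homotopicA f1 g1.
  apply: (homotopic_shift (s := s1) oV ppsi kI s1I _ f1E) => // n n0.
  by rewrite /s1 -addnn ltnS leq_addl.
apply: (homotopic_trans fg0); apply: homotopic_trans (homotopic_sym fg1).
apply: (homotopic_disjoint oU oV pphi ppsi i0I k1I) => // i j /= /(congr1 odd).
by rewrite /s0 /s1 /= !odd_double.
Qed.

End CoverHomotopies.

(** * Doubled covers *)

Section ApproximateEquality.
Context {R : realType} {d : nat}.
Implicit Types A C P Q : 'M[R]_d.

Lemma orthogonal_invmx A : orthogonal_group A -> invmx A = A^T.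
Proof.
move=> oA; have uA := orthogonal_unit oA.
by apply: (can_inj (mulKmx uA)); rewrite mulmxV// orthogonal_mulV.
Qed.

Lemma orthogonal_trmx A : orthogonal_group A -> orthogonal_group A^T.
Proof. by move=> oA; rewrite /orthogonal_group/= trmxK; exact: orthogonal_mulV. Qed.

Lemma approx_eq_mul (e : \bar R) A C P Q : orthogonal_group A -> orthogonal_group C ->
  approx_eq e P Q -> approx_eq e (A *m P *m C) (A *m Q *m C).
Proof.
move=> oA oC; rewrite /approx_eq; case: ifP => [_ ->//|_].
rewrite -mulmxBl -mulmxBr frob_mulmxr ?frob_mulmxl//.
exact: orthogonal_mulV.
Qed.

Lemma approx_eq_le (e e' : \bar R) P Q : (0 <= e)%E -> (e <= e')%E ->
  approx_eq e P Q -> approx_eq e' P Q.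
Proof.
move=> e0 ee'; rewrite /approx_eq; have [e'0|e'0] := eqVneq e' 0%E.
  suff /eqP -> : e == 0%E by rewrite eqxx.
  by rewrite eq_le e0 -e'0 ee'.
case: eqP => [_ ->|_ lt]; last exact: lt_le_trans lt ee'.
by rewrite subrr frob0 lt_neqAle eq_sym e'0 (le_trans e0 ee').
Qed.

Lemma approx_eq_sym (e : \bar R) P Q : approx_eq e P Q -> approx_eq e Q P.
Proof. by rewrite /approx_eq; case: ifP => // _; rewrite -frobN opprB. Qed.

(** The triangle inequality. As delta exceeds a norm it is positive, so e + delta never falls under
    the convention for 0. *)
Lemma approx_eq_trans (e delta : \bar R) P P' Q : (0 <= e)%E ->
  ((frob (P' - P))%:E < delta)%E -> approx_eq e P Q -> approx_eq (e + delta)%E P' Q.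
Proof.
move=> e0 PP' PQ; have d0 : (0 < delta)%E.
  by apply: le_lt_trans PP'; rewrite lee_fin frob_ge0.
have -> : approx_eq (e + delta) P' Q = ((frob (P' - Q))%:E < e + delta)%E :> Prop.
  by rewrite /approx_eq gt_eqF// (lt_le_trans d0)// leeDr.
have tri : frob (P' - Q) <= frob (P - Q) + frob (P' - P).
  have -> : P' - Q = P - Q + (P' - P) by rewrite [RHS]addrC addrA subrK.
  exact: frobD.
apply: (@le_lt_trans _ _ (frob (P - Q) + frob (P' - P))%:E); first by rewrite lee_fin.
move: PQ; rewrite /approx_eq EFinD; case: eqP => [-> <-|_ lt].
  by rewrite subrr frob0 !add0e.
exact: lteD.
Qed.

End ApproximateEquality.

Section Doubling.
Context {R : realType} {B : topologicalType} {I : countType} {U : I -> set B}.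
Context {d : nat} {e : \bar R}.
Hypothesis oU : forall i, open (U i).
Hypothesis e_ge0 : (0 <= e)%E.

Section GaugeAction.
Context {K : Type} {W : K -> set B} (Om : Z1 R W d e) (Th : K -> B -> 'M[R]_d).
Hypothesis gTh : is_gauge W Th.

(** The transpose stands for the inverse, which makes continuity immediate. *)
Let act i j y := Th i y *m Om i j y *m (Th j y)^T.

Let act_orthogonal i j y : (W j `&` W i) y -> orthogonal_group (act i j y).
Proof.
move=> [Wj Wi]; have [_ oTh] := gTh.
apply: orthogonal_mul; last by apply: orthogonal_trmx; exact: oTh.
by apply: orthogonal_mul; [exact: oTh|apply: Z1_orthogonal].
Qed.

Let act_continuous i j : {within W j `&` W i, continuous (act i j)}.
Proof.
have [cTh _] := gTh => y; apply: cvg_mulmx; first apply: cvg_mulmx.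
- by apply: (continuous_subspaceW _ (cTh i)) => // z [].
- exact: Z1_continuous.
- by apply: cvg_trmx; apply: (continuous_subspaceW _ (cTh j)) => // z [].
Qed.

Let act_inv i j y : (W j `&` W i) y -> act i j y = invmx (act j i y).
Proof.
move=> Wij; have [Wj Wi] := Wij; rewrite orthogonal_invmx; last exact: act_orthogonal.
rewrite /act !trmx_mul trmxK -mulmxA (@Z1_inv _ _ _ _ _ _ Om)// orthogonal_invmx//.
exact: Z1_orthogonal.
Qed.

Let act_approx i j k y : (W k `&` W j `&` W i) y ->
  approx_eq e (act i j y *m act j k y) (act i k y).
Proof.
move=> Wijk; have [[Wk Wj] Wi] := Wijk; have [_ oTh] := gTh.
have -> : act i j y *m act j k y = Th i y *m (Om i j y *m Om j k y) *m (Th k y)^T.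
  by rewrite /act !mulmxA -(mulmxA _ (Th j y)^T) oTh// mulmx1.
apply: approx_eq_mul; [exact: oTh|by apply: orthogonal_trmx; exact: oTh|].
exact: Z1_approx.
Qed.

Definition Z1_gauge : Z1 R W d e :=
  Cocycle act_orthogonal act_continuous act_inv act_approx.

End GaugeAction.

(** Pull Om back to two copies of the cover and apply the gauge that is 1 on the first copy and Th
    on the second: the two restrictions are Om and La. *)
Lemma homotopic_gauge (Om La : Z1 R U d e) phi psi (iota kappa : I -> nat)
    (f0 f1 : B -> infmx R) : gauge_equiv Om La ->
  partition_of_unity U phi -> partition_of_unity U psi ->
  index_injection iota -> index_injection kappa ->
  (forall x k l, f0 x k l = cl_entry phi iota Om x k l) ->
  (forall x k l, f1 x k l = cl_entry psi kappa La x k l) ->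
  homotopic R (Gr_thick d ((Num.sqrt 2)%:E * e)%E) f0 f1.
Proof.
move=> [Th [cTh oTh] ThE] pphi ppsi iI kI f0E f1E.
have fold : refinement U (sum_cover U U) (sum_fun id id) by move=> [] ? ?.
have gTh : is_gauge (sum_cover U U) (sum_fun (fun _ _ => 1%:M) Th).
  split=> -[i|i]; [|exact: cTh| |exact: oTh].
    by apply: continuous_subspaceT => y; exact: cvg_cst.
  by move=> y _; rewrite /orthogonal_group/= trmx1 mulmx1.
apply: (homotopic_sum_cover e_ge0 (D := Z1_gauge (Z1_refine fold Om) gTh)
  oU oU pphi ppsi iI kI) => x k l.
- rewrite f0E; apply: (cl_entry_reindex (h := id)) => // i j _ _ /=.
  by rewrite trmx1 mulmx1 mul1mx.
rewrite f1E; apply: (cl_entry_reindex (h := id)) => //.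
have [_ _ sU _ _] := ppsi.
(* La is known to be the gauge transform only on overlaps, and nonzero weights place x in one. *)
move=> i j ix jx /=; have Ui : U i x by apply: (sU i); exact: subset_closure.
have Uj : U j x by apply: (sU j); exact: subset_closure.
by rewrite ThE// orthogonal_invmx//; exact: oTh.
Qed.

Section Mixing.
Context (delta : \bar R) (Om La : Z1 R U d e).
Hypothesis near_cochains : forall i j y, (U j `&` U i) y ->
  ((frob (Om i j y - La i j y))%:E < delta)%E.

Let idx : I + I -> I := sum_fun id id.

(** La is used only between two indices of the second copy. With this choice every triple condition
    differs from one for Om or La in at most one factor, so the error grows by a single delta. *)
Let mix (a b : I + I) : B -> 'M[R]_d :=
  match a, b with inr i, inr j => La i j | _, _ => Om (idx a) (idx b) end.

Let W := sum_cover U U.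

Let W_idx a y : W a y = U (idx a) y. Proof. by case: a. Qed.

Let mix_orthogonal a b y : (W b `&` W a) y -> orthogonal_group (mix a b y).
Proof. by case: a b => [i|i] [j|j] Wy; apply: Z1_orthogonal. Qed.

Let mix_continuous a b : {within W b `&` W a, continuous (mix a b)}.
Proof.
by case: a b => [i|i] [j|j];
  [exact: (@Z1_continuous _ _ _ _ _ _ Om)..|exact: (@Z1_continuous _ _ _ _ _ _ La)].
Qed.

Let mix_inv a b y : (W b `&` W a) y -> mix a b y = invmx (mix b a y).
Proof. by case: a b => [i|i] [j|j] Wy; apply: Z1_inv. Qed.

Let mix_approx a b c y : (W c `&` W b `&` W a) y ->
  approx_eq (e + delta)%E (mix a b y *m mix b c y) (mix a c y).
Proof.
case=> [[]]; rewrite !W_idx => Uc Ub Ua.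
have d0 : (0 <= delta)%E.
  apply: ltW; apply: le_lt_trans (near_cochains (conj Ua Ua)).
  by rewrite lee_fin frob_ge0.
have weak P Q : approx_eq e P Q -> approx_eq (e + delta)%E P Q.
  by apply: approx_eq_le => //; exact: leeDl.
have OmA : approx_eq e (Om (idx a) (idx b) y *m Om (idx b) (idx c) y) (Om (idx a) (idx c) y).
  by apply: Z1_approx.
have LaA : approx_eq e (La (idx a) (idx b) y *m La (idx b) (idx c) y) (La (idx a) (idx c) y).
  by apply: Z1_approx.
have near' i j : U j y -> U i y -> ((frob (La i j y - Om i j y))%:E < delta)%E.
  by move=> Uj Ui; rewrite -frobN opprB; apply: near_cochains.
have oOm i j : U j y -> U i y -> orthogonal_group (Om i j y).
  by move=> Uj Ui; apply: Z1_orthogonal.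
(* Five of the eight triples involve Om alone or La alone. In each of the other three a single La
   occurs among values of Om: as second factor, as the product to be approximated, and as first
   factor. *)
case: a b c Ua Ub Uc OmA LaA => [i|i] [j|j] [k|k] Ua Ub Uc OmA LaA; try exact: weak.
- apply: approx_eq_trans OmA => //; rewrite -mulmxBr frob_mulmxl; last exact: oOm.
  exact: near'.
- apply: approx_eq_sym; apply: approx_eq_trans (approx_eq_sym OmA) => //.
  exact: near'.
- apply: approx_eq_trans OmA => //; rewrite -mulmxBl frob_mulmxr; first exact: near'.
  by apply: orthogonal_mulV; exact: oOm.
Qed.

Definition Z1_mix : Z1 R W d (e + delta)%E :=
  Cocycle mix_orthogonal mix_continuous mix_inv mix_approx.

Lemma homotopic_near_cochains phi psi (iota kappa : I -> nat) (f0 f1 : B -> infmx R) :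
  (0 <= delta)%E -> partition_of_unity U phi -> partition_of_unity U psi ->
  index_injection iota -> index_injection kappa ->
  (forall x k l, f0 x k l = cl_entry phi iota Om x k l) ->
  (forall x k l, f1 x k l = cl_entry psi kappa La x k l) ->
  homotopic R (Gr_thick d ((Num.sqrt 2)%:E * (e + delta))%E) f0 f1.
Proof.
move=> d0 pphi ppsi iI kI f0E f1E.
by apply: (homotopic_sum_cover _ (D := Z1_mix) oU oU pphi ppsi iI kI) => //; exact: adde_ge0.
Qed.

End Mixing.

End Doubling.

Section RefinementInvariance.
Context {R : realType} {B : topologicalType} {I J : countType}.
Context {U : I -> set B} {V : J -> set B} {d : nat} {e : \bar R}.

(** Together mu and nu form one refinement from two copies of V to U, and the pullback of Om along
    it restricts to both given cocycles. *)
Lemma homotopic_refinements (mu nu : J -> I) (hmu : refinement U V mu)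
    (hnu : refinement U V nu) (Om : Z1 R U d e) phi psi (iota kappa : J -> nat)
    (f0 f1 : B -> infmx R) : (0 <= e)%E -> (forall j, open (V j)) ->
  partition_of_unity V phi -> partition_of_unity V psi ->
  index_injection iota -> index_injection kappa ->
  (forall x k l, f0 x k l = cl_entry phi iota (Z1_refine hmu Om) x k l) ->
  (forall x k l, f1 x k l = cl_entry psi kappa (Z1_refine hnu Om) x k l) ->
  homotopic R (Gr_thick d ((Num.sqrt 2)%:E * e)%E) f0 f1.
Proof.
move=> e0 oV pphi ppsi iI kI f0E f1E.
have h : refinement U (sum_cover V V) (sum_fun mu nu).
  by move=> [j|j]; [exact: hmu|exact: hnu].
exact: (homotopic_sum_cover e0 (D := Z1_refine h Om) oV oV pphi ppsi iI kI).
Qed.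

End RefinementInvariance.

(** * The classifying map on cohomology classes *)

Lemma dZ_lt (R : realType) (B : topologicalType) (I : Type) (U : I -> set B) (d : nat)
    (e delta : \bar R) (Om La : Z1 R U d e) i j y :
  (dZ Om La < delta)%E -> (U j `&` U i) y ->
  ((frob (Om i j y - La i j y))%:E < delta)%E.
Proof.
move=> lt Uy; apply: le_lt_trans lt; apply: ereal_sup_ubound.
by right; exists i, j, y.
Qed.

Theorem theorem4p21 (R : realType) (B : topologicalType) (hB : paracompact B)
    (I : countType) (U : I -> set B) (hU : open_cover U)
    (d : nat) (hd : (0 < d)%N) (eps : \bar R) (heps : (0 <= eps)%E) :
  exists cl : H1 R U d eps ->
              hclasses R B (Gr_thick d ((Num.sqrt 2)%:E * eps)%E),
    [/\ is_cl' (fun Om : Z1 R U d eps => cl (\pi_(H1 R U d eps) Om)),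
        forall (delta : \bar R) (hdelta : (0 <= delta)%E) (x z : H1 R U d eps),
          (dH x z < delta)%E ->
          hincl (Gr_thick_addr heps hdelta) (cl x) =
          hincl (Gr_thick_addr heps hdelta) (cl z)
      & forall (J : countType) (V : J -> set B) (hV : open_cover V)
          (mu nu : J -> I) (hmu : refinement U V mu) (hnu : refinement U V nu)
          (clV : H1 R V d eps ->
                 hclasses R B (Gr_thick d ((Num.sqrt 2)%:E * eps)%E)),
          is_cl' (fun Om : Z1 R V d eps => clV (\pi_(H1 R V d eps) Om)) ->
          forall x : H1 R U d eps,
            hincl (Gr_thick_double heps) (clV (H1_refine hmu x)) =
            hincl (Gr_thick_double heps) (clV (H1_refine hnu x))].
Proof.
have [oU _] := hU.
have [phi0 pphi0] := paracompact_partition_of_unity hB R hU.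
(* The successor is taken because positions must be positive. *)
pose iota0 (i : I) := (choice.pickle i).+1.
have iI0 : index_injection iota0.
  by split=> // i j [] /(pcan_inj choice.pickleK).
have pos_inj (phi : I -> B -> R) (iota : I -> nat) : index_injection iota ->
    forall y a b, phi a y != 0 -> phi b y != 0 -> iota a = iota b -> a = b.
  by move=> [iI _] y a b _ _ /iI.
pose clmap phi iota pphi iI Om :=
  @cl_map R B I U d eps phi iota Om oU pphi (pos_inj phi iota iI) heps.
(* This fixes a representative, a partition of unity and an injection; [homotopic_gauge] removes the
   dependence on all three at once. *)
pose cl (x : H1 R U d eps) :=
  \pi_(hclasses R B (Gr_thick d ((Num.sqrt 2)%:E * eps)%E)) (clmap phi0 iota0 pphi0 iI0 (repr x)).
have clE : is_cl' (fun Om : Z1 R U d eps => cl (\pi_(H1 R U d eps) Om)).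
  split; first by exists phi0, iota0.
  move=> phi iota pphi iI Om; exists (clmap phi iota pphi iI Om) => //.
  apply/hclassesP; have /H1P g : \pi_(H1 R U d eps) (repr (\pi_(H1 R U d eps) Om)) =
    \pi_(H1 R U d eps) Om by rewrite reprK.
  exact: (homotopic_gauge oU heps g pphi0 pphi iI0 iI).
exists cl; split=> // [delta d0 x z|J V [oV _] mu nu hmu hnu clV [[phi [iota [pphi iI]]] hV] x].
  (* An infimum below delta is witnessed by actual representatives at distance below delta. *)
  move=> /ereal_inf_lt[_ [Om [La [<- <- ->]]] lt].
  have [f fE ->] := clE.2 _ _ pphi0 iI0 Om; have [g gE ->] := clE.2 _ _ pphi0 iI0 La.
  rewrite !hinclE; apply/hclassesP.
  apply: (homotopic_near_cochains oU heps _ d0 pphi0 pphi0 iI0 iI0 fE gE).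
  by move=> i j y; exact: dZ_lt.
rewrite -[x]reprK !H1_refineE.
have [f fE ->] := hV _ _ pphi iI (Z1_refine hmu (repr x)).
have [g gE ->] := hV _ _ pphi iI (Z1_refine hnu (repr x)).
rewrite !hinclE; apply/hclassesP; apply: (homotopic_sub (Gr_thick_double heps)).
exact: (homotopic_refinements heps oV pphi pphi iI iI fE gE).
Qed.
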